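(* Let $n\ge3$, $\emptyset\neq S\subseteq\{1,\dots,n-1\}$, $\mathfrak p:=\sum_{i\in S}\mathfrak p_i'$. Define the subgroup $$\mathcal E(\mathbb S_{n-1},\mathfrak p):=\prod_{|I|=2,\ I\in\mathcal J(\mathfrak p)}E_\infty(\mathbb S_{CI})\cdot(1+\mathfrak p\mathfrak p_n)^*_3$$ of $(1+\mathfrak p\mathfrak p_n)^*=\mathrm{GL}_\infty(\mathbb S_{n-1},\mathfrak p)$. Then $\mathcal E(\mathbb S_{n-1},\mathfrak p)=E_\infty(\mathbb S_{n-1},\mathfrak p)$.
   Context: $K$ is a field, $\mathbb N=\{0,1,\dots\}$. $\mathbb S_n$ is the $K$-algebra generated by $x_1,\dots,x_n,y_1,\dots,y_n$ with relations $y_ix_i=1$, $[x_i,y_j]=[x_i,x_j]=[y_i,y_j]=0$ ($i\ne j$). $E_{st}(i):=x_i^sy_i^t-x_i^{s+1}y_i^{t+1}$, $e_i:=E_{00}(i)$. For $I\subseteq\{1,\dots,n\}$ and $\alpha,\beta\in\mathbb N^I$, $E_{\alpha\beta}(I):=\prod_{i\in I}E_{\alpha_i\beta_i}(i)$; $CI$ is the complement of $I$; $\mathbb S_{CI}$ is the subalgebra generated by $x_k,y_k$, $k\in CI$; $E_\infty(\mathbb S_{CI})$ is the subgroup of $\mathbb S_n^*$ generated by all $1+aE_{\alpha\beta}(I)$, $a\in\mathbb S_{CI}$, $\alpha\ne\beta\in\mathbb N^I$. $\mathfrak p_i$ is the ideal of $\mathbb S_n$ generated by $e_i$, $\mathfrak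 p_I:=\prod_{i\in I}\mathfrak p_i$, $\mathfrak a_{n,s}:=\sum_{|I|=s}\mathfrak p_I$. For an ideal $\mathfrak b$ of $\mathbb S_n$, $(1+\mathfrak b)^*$ is the group of units of $\mathbb S_n$ in $1+\mathfrak b$. $\mathbb S_{n-1}$ is the subalgebra generated by $x_1,\dots,x_{n-1},y_1,\dots,y_{n-1}$; $\mathfrak p_i'$ the ideal of $\mathbb S_{n-1}$ generated by $e_i$. $\mathfrak p\mathfrak p_n:=\sum_{i\in S}\mathfrak p_i\mathfrak p_n$; $(1+\mathfrak p\mathfrak p_n)^*_s:=(1+\mathfrak p\mathfrak p_n)^*\cap(1+\mathfrak a_{n,s})^*$. $\mathcal J(\mathfrak p):=\{J\subseteq\{1,\dots,n\}: n\in J,\ J\cap S\ne\emptyset\}$. The product $\prod E_\infty(\mathbb S_{CI})$ is the set of products of elements of these subgroups in a fixed order. $\mathrm{GL}_\infty(\mathbb S_{n-1})$ is identified with $(1+\mathfrak p_n)^*$ via $(a_{kl})\mapsto1+\sum(a_{kl}-\delta_{kl})E_{kl}(n)$, and then $\mathrm{GL}_\infty(\mathbb S_{n-1},\mathfrak p):=\ker(\mathrm{GL}_\infty(\mathbb S_{n-1})\to\mathrm{GL}_\infty(\mathbb S_{n-1}/\mathfrak p))$ corresponds to $(1+\mathfrak p\mathfrak p_n)^*$. $E_\infty(\mathbb S_{n-1},\mathfrak p)$ is the relative elementary group: the normal subgroup of $E_\infty(\mathbb S_{n-1})$ generated by the matrices $1+aE_{kl}$ with $a\in\mathfrak p$,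 $k\ne l$. *)

(* Defs.v *)
From HB Require Import structures.
From mathcomp Require Import all_boot all_order all_algebra.
Set Implicit Arguments. Unset Strict Implicit. Unset Printing Implicit Defensive.
Import GRing.Theory.
Local Open Scope ring_scope.

(* The algebra S_n is presented abstractly: an algebra A over a field K together
   with x_i, y_i (indices 'I_N, index i standing for i+1) satisfying the defining
   relations and the universal property of the presentation (generated by the
   x_i, y_i, and every family satisfying the relations in any K-algebra is the
   image of an algebra morphism). *)

Definition jac_rels (K : fieldType) (B : algType K) (N : nat) (x y : 'I_N -> B) : Prop :=
  (forall i, y i * x i = 1) /\
  (forall i j, i != j ->
     [/\ x i * y j = y j * x i, x i * x j = x j * x i & y i * y j = y j * y i]).

Inductive subalg_gen (K : fieldType) (B : algType K) (N : nat) (x y : 'I_N -> B)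
    (J : pred 'I_N) : B -> Prop :=
  | sg_scal (k : K) : subalg_gen x y J (k%:A)
  | sg_x i : J i -> subalg_gen x y J (x i)
  | sg_y i : J i -> subalg_gen x y J (y i)
  | sg_add a b : subalg_gen x y J a -> subalg_gen x y J b -> subalg_gen x y J (a + b)
  | sg_mul a b : subalg_gen x y J a -> subalg_gen x y J b -> subalg_gen x y J (a * b).

Definition is_jacobian_algebra (K : fieldType) (A : algType K) (N : nat)
    (x y : 'I_N -> A) : Prop :=
  jac_rels x y /\
  (forall a, subalg_gen x y predT a) /\
  (forall (B : algType K) (xb yb : 'I_N -> B), jac_rels xb yb ->
     exists f : A -> B,
       [/\ forall a b, f (a + b) = f a + f b,
           forall a b, f (a * b) = f a * f b,
           forall (k : K) a, f (k *: a) = k *: f a,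
           f 1 = 1 &
           forall i, f (x i) = xb i /\ f (y i) = yb i]).

(* two-sided ideal of the subring R generated by P (P assumed inside R) *)
Inductive ideal_in (B : pzRingType) (R P : B -> Prop) : B -> Prop :=
  | id_base a : P a -> ideal_in R P a
  | id_0 : ideal_in R P 0
  | id_add a b : ideal_in R P a -> ideal_in R P b -> ideal_in R P (a + b)
  | id_mull r a : R r -> ideal_in R P a -> ideal_in R P (r * a)
  | id_mulr r a : R r -> ideal_in R P a -> ideal_in R P (a * r).

Definition ideal (B : pzRingType) (P : B -> Prop) : B -> Prop :=
  ideal_in (fun _ => True) P.

Definition ideal_mul (B : pzRingType) (I J : B -> Prop) : B -> Prop :=
  ideal (fun a => exists b c, [/\ I b, J c & a = b * c]).

Definition is_unit_el (B : pzRingType) (u : B) : Prop :=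
  exists v, u * v = 1 /\ v * u = 1.

Definition units1 (B : pzRingType) (b : B -> Prop) (u : B) : Prop :=
  is_unit_el u /\ b (u - 1).

Inductive gen_group (B : pzRingType) (G : B -> Prop) : B -> Prop :=
  | gg_one : gen_group G 1
  | gg_mul g a : G g -> gen_group G a -> gen_group G (g * a)
  | gg_inv g h a : G g -> g * h = 1 -> h * g = 1 -> gen_group G a ->
                   gen_group G (h * a).

Fixpoint prodset (B : pzRingType) (l : seq (B -> Prop)) : B -> Prop :=
  match l with
  | [::] => fun a => a = 1
  | P :: l' => fun a => exists b c, [/\ P b, prodset l' c & a = b * c]
  end.

Section Jacobian.
Variables (K : fieldType) (A : algType K) (m : nat) (x y : 'I_m.+1 -> A).
(* n = m.+1; the index n is ord_max *)

Definition Eelt (s t : nat) (i : 'I_m.+1) : A :=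
  x i ^+ s * y i ^+ t - x i ^+ s.+1 * y i ^+ t.+1.

Definition eelt (i : 'I_m.+1) : A := Eelt 0 0 i.

(* E_{alpha beta}(I); only the values of alpha, beta on I matter *)
Definition Emat (I : {set 'I_m.+1}) (al be : 'I_m.+1 -> nat) : A :=
  \prod_(i in I) Eelt (al i) (be i) i.

Definition SC (I : {set 'I_m.+1}) : A -> Prop := subalg_gen x y (fun k => k \notin I).

Definition Einf (I : {set 'I_m.+1}) : A -> Prop :=
  gen_group (fun u => exists a (al be : 'I_m.+1 -> nat),
     [/\ SC I a, exists2 i, i \in I & al i != be i & u = 1 + a * Emat I al be]).

Definition pid (i : 'I_m.+1) : A -> Prop := ideal (fun a => a = eelt i).
Definition pI (I : {set 'I_m.+1}) : A -> Prop :=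
  foldr (fun i acc => ideal_mul (pid i) acc) (fun _ => True) (enum I).
Definition ans (s : nat) : A -> Prop :=
  ideal (fun a => exists I : {set 'I_m.+1}, #|I| = s /\ pI I a).

Definition Snm1 : A -> Prop := subalg_gen x y (fun k => k != ord_max).
Definition pprime (i : 'I_m.+1) : A -> Prop := ideal_in Snm1 (fun a => a = eelt i).
Definition pS (S : {set 'I_m.+1}) : A -> Prop :=
  ideal_in Snm1 (fun a => exists2 i, i \in S & pprime i a).

(* p p_n = sum_{i in S} p_i p_n *)
Definition ppn (S : {set 'I_m.+1}) : A -> Prop :=
  ideal (fun a => exists2 i, i \in S & ideal_mul (pid i) (pid ord_max) a).

Definition units_ppn_3 (S : {set 'I_m.+1}) (u : A) : Prop :=
  units1 (ppn S) u /\ units1 (ans 3) u.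

Definition Jp (S : {set 'I_m.+1}) : pred {set 'I_m.+1} :=
  fun J => (ord_max \in J) && (J :&: S != set0).

Definition Ecal (S : {set 'I_m.+1}) : A -> Prop :=
  prodset ([seq Einf J | J <- enum [pred J : {set 'I_m.+1} | (#|J| == 2) && Jp S J]]
           ++ [:: units_ppn_3 S]).

(* E_infty(S_{n-1}) inside (1 + p_n)^* : generated by 1 + a E_{kl}(n), a in S_{n-1}, k != l *)
Definition Einf_nm1 : A -> Prop :=
  gen_group (fun u => exists a (k l : nat), [/\ Snm1 a, k != l & u = 1 + a * Eelt k l ord_max]).

Definition Erel (S : {set 'I_m.+1}) : A -> Prop :=
  gen_group (fun u => exists g h a (k l : nat),
    [/\ Einf_nm1 g, g * h = 1 /\ h * g = 1, pS S a, k != l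
      & u = g * (1 + a * Eelt k l ord_max) * h]).

End Jacobian.

(* Main.v *)
Require Import Defs.
From HB Require Import structures.
From mathcomp Require Import all_boot all_order all_algebra boolp.
From Stdlib Require Ncring Ncring_tac.
Set Implicit Arguments. Unset Strict Implicit. Unset Printing Implicit Defensive.
Import GRing.Theory.
Local Open Scope ring_scope.

(** Every unit of the form [1 + v w] with [w v = 0] is a commutator of elementary
    matrices after enlarging the index set, so each group [E_oo(S_CI)] with
    [I = {i, n}] is normalised by all units; this gives the inclusion of the
    relative elementary group in the product.

    For the converse the point is that units [u] in [1 + p p_n] congruent to 1
    modulo [a_{n,3}] are relatively elementary.  Vaserstein's identity shows that
    [1 + v w] and [1 + w v] agree modulo the relative elementary group.  For [c]
    commuting with [x_j, y_j], taking [v = y_j] and [w = x_j c] gives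
    [1 + c ~ 1 + c x_j y_j], whence [1 + c e_j ~ 1].  These identities are
    universal words in [c] and an inverse of [1 + c], so they hold modulo any
    ideal [Q] for which [1 + c] is invertible modulo [Q]; the summands
    [p_i p_j p_n] of [u - 1] are thereby removed one at a time.  That [1 + c] is
    invertible modulo [Q] as soon as [1 + c e_j] is uses the universal property
    of the algebra, through its action on sequences by shifts. *)

(** * Noncommutative identities *)

(** The obstacle is that a summand of [u - 1] cannot be split off inside the unit group: if
    [u - 1 = b + q] with [b] in the ideal of [e_i e_j e_n], then [1 + b] is known to be invertible
    only modulo an ideal containing [q]. The identities therefore carry an approximate inverse
    [1 + z'] and display the error as multiples of [(1 + v w)(1 + z') - 1] or of the same expression
    in the other order, while the elementary words in them remain genuine group elements. The
    outcome is an honest [eps] in the relative group such that [eps^-1 u] is a unit congruent to 1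
    modulo the ideal of [q], and the induction resumes with that unit.

    Passing from [1 + c e_j] to [1 + c] requires a modulus whose generators do not involve [j]. For
    this reason the triples of the indices still to be treated are first enlarged to the family
    [e_k e_n], and the excess is removed afterwards by intersecting two ideals. *)

Section RingIdentities.
Import Ncring Ncring_tac.
Local Open Scope ring_scope.
Variable R : pzRingType.

#[local] Instance pzRing_ops :
  @Ring_ops R 0 1 +%R *%R (fun a b => a - b) -%R eq := {}.
#[local] Instance pzRing_ring :
  @Ring R 0 1 +%R *%R (fun a b => a - b) -%R eq pzRing_ops.
Proof.
split; rewrite /addition /multiplication /subtraction /opposite /equality /=.
- exact: RelationClasses.eq_equivalence.
- by move=> a b -> c d ->.
- by move=> a b -> c d ->.
- by move=> a b -> c d ->.
- by move=> a b ->.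
- exact: add0r.
- exact: addrC.
- exact: addrA.
- exact: mul1r.
- exact: mulr1.
- exact: mulrA.
- exact: mulrDl.
- by move=> a b c; exact: mulrDr.
- by [].
- exact: subrr.
Qed.

(* [w X = 0 = Y v] makes [v Y] and [X w] square-zero corner blocks of a 2 x 2
   matrix, and the left-hand side is the product L(-wz) U(v) L(w) U(-zv). *)
Lemma vaserstein_word (X Y v w z' : R) :
  Y * X = 1 -> Y * v = 0 -> Y * z' = 0 -> w * X = 0 -> z' * X = 0 ->
  (1 - X * (w + w * z')) * (1 + v * Y) * (1 + X * w) * (1 - (v + z' * v) * Y) =
  (1 + v * w) * (1 - X * (w * (1 + z') * v) * Y)
  - ((1 + v * w) * (1 + z') - 1) * v * Y
  - X * w * ((1 + z') * (1 + v * w) - 1) * (1 - (v + z' * v) * Y).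
Proof.
move=> YX Yv Yz wX zX.
have -> : (1 - X * (w + w * z')) * (1 + v * Y) * (1 + X * w) =
    1 + v * Y + v * w - X * (w * (1 + z') * v) * Y
    - X * w * ((1 + z') * (1 + v * w) - 1).
  (* The free identity carries along the terms in [Y X - 1], [w X] and [z' X], which the hypotheses
     then kill. *)
  transitivity (1 + v * Y + v * w - X * (w * (1 + z') * v) * Y
    - X * w * ((1 + z') * (1 + v * w) - 1)
    + (1 - X * (w + w * z')) * v * (Y * X - 1) * w
    - X * (w * X + w * (z' * X)) * w).
    non_commutative_ring.
  rewrite YX wX zX; non_commutative_ring.
transitivity ((1 + v * w) * (1 - X * (w * (1 + z') * v) * Y)
  - ((1 + v * w) * (1 + z') - 1) * v * Y
  - X * w * ((1 + z') * (1 + v * w) - 1) * (1 - (v + z' * v) * Y)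
  - v * (Y * v + Y * z' * v) * Y
  + X * (w * (1 + z') * v) * (Y * v + Y * z' * v) * Y
  + v * (w * X) * (w * (1 + z') * v) * Y).
  non_commutative_ring.
rewrite Yv Yz wX; non_commutative_ring.
Qed.

(** With P = v Y and Q = X w the relations give P P = Q Q = Q P = 0 and P Q = v w, so the left-hand
    side is the commutator of 1 + P and 1 + Q. *)
Lemma commutator_word (X Y v w : R) :
  Y * X = 1 -> Y * v = 0 -> w * X = 0 -> w * v = 0 ->
  (1 + v * Y) * (1 + X * w) * (1 - v * Y) * (1 - X * w) = 1 + v * w.
Proof.
move=> YX Yv wX wv.
have -> : (1 + v * Y) * (1 + X * w) * (1 - v * Y) = 1 + X * w + v * w.
  transitivity (1 + X * w + v * w - v * (Y * v) * Y + v * (Y * X - 1) * w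
    - X * (w * v) * Y - v * (Y * X) * (w * v) * Y).
    non_commutative_ring.
  rewrite YX Yv wv; non_commutative_ring.
transitivity (1 + v * w - X * (w * X) * w - v * (w * X) * w).
  non_commutative_ring.
rewrite wX; non_commutative_ring.
Qed.

(** A Steinberg relation; it will produce elements that are diagonal in the index [n] from
    off-diagonal ones. *)
Lemma square_zero_commutator (X Y : R) :
  X * X = 0 -> Y * Y = 0 -> Y * X = 0 ->
  (1 + X) * (1 + Y) * (1 - X) * (1 - Y) = 1 + X * Y.
Proof.
move=> XX YY YX; have -> : (1 + X) * (1 + Y) * (1 - X) = 1 + Y + X * Y.
  transitivity (1 + Y + X * Y - X * X - Y * X - X * (Y * X)).
    non_commutative_ring.
  rewrite XX YX; non_commutative_ring.
transitivity (1 + X * Y - Y * Y - X * (Y * Y)); first non_commutative_ring.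
rewrite YY; non_commutative_ring.
Qed.

(** If [1 + z'] inverts [1 + v w], then [1 - w (1 + z') v] inverts [1 + w v]; the right-hand side is
    the error for an approximate inverse. *)
Lemma swap_inverse_l (v w z' : R) :
  (1 + w * v) * (1 - w * (1 + z') * v) - 1 =
  - (w * ((1 + v * w) * (1 + z') - 1) * v).
Proof. non_commutative_ring. Qed.

Lemma swap_inverse_r (v w z' : R) :
  (1 - w * (1 + z') * v) * (1 + w * v) - 1 =
  - (w * ((1 + z') * (1 + v * w) - 1) * v).
Proof. non_commutative_ring. Qed.

(** Approximate form of [w v (1 + w v)^-1 = w (1 + v w)^-1 v]. *)
Lemma swap_shift (v w z' : R) :
  w * v * (1 - w * (1 + z') * v) = w * (1 + z') * v
    - w * ((1 + v * w) * (1 + z') - 1) * v.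
Proof. non_commutative_ring. Qed.

(** For an exact inverse [1 + c'] one has [(1 + c) c (1 + c') = c], which leaves
    [1 + c - c (1 - e)]; the right-hand side collects the error. *)
Lemma swindle_identity (c c' e : R) :
  (1 + c) * (1 - c * (1 + c') * (1 - e)) - (1 + c * e) =
  ((1 + c) * (1 + c') - 1) * (1 - e)
  - (1 + c) * ((1 + c) * (1 + c') - 1) * (1 - e).
Proof. non_commutative_ring. Qed.

Lemma one_sub_inverse (u u' b q : R) : u' * u = 1 -> u - 1 = b + q ->
  u' - 1 = - u' * b - u' * q.
Proof.
move=> u'u E; transitivity (u' * u - u' * (u - 1) - 1); first non_commutative_ring.
rewrite u'u E; non_commutative_ring.
Qed.

(** The factors differ from the mutually inverse [u] and [u'] only by [q] and [q'], so they are
    inverse modulo any ideal containing both. *)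
Lemma inverse_up_to (u u' b q b' q' : R) : u * u' = 1 ->
  u - 1 = b + q -> u' - 1 = b' + q' ->
  (1 + b) * (1 + b') - 1 = - q * u' - (1 + b) * q'.
Proof.
move=> uu' E E'.
have -> : b' = u' - 1 - q' by rewrite E' addrK.
have -> : b = u - 1 - q by rewrite E addrK.
transitivity (u * u' - 1 - q * u' - (1 + (u - 1 - q)) * q').
  non_commutative_ring.
rewrite uu'; non_commutative_ring.
Qed.

End RingIdentities.

(** * Ideals and generated groups *)

Section IdealsAndGroups.
Variable R : pzRingType.
Implicit Types (D P Q G : R -> Prop) (a b r u v h : R).

Lemma ideal_incl D a : D a -> ideal D a.
Proof. exact: id_base. Qed.

Lemma ideal0 D : ideal D 0.
Proof. exact: id_0. Qed.

Lemma ideal_add D a b : ideal D a -> ideal D b -> ideal D (a + b).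
Proof. exact: id_add. Qed.

Lemma ideal_mull D r a : ideal D a -> ideal D (r * a).
Proof. exact: id_mull. Qed.

Lemma ideal_mulr D r a : ideal D a -> ideal D (a * r).
Proof. exact: id_mulr. Qed.

Lemma ideal_opp D a : ideal D a -> ideal D (- a).
Proof. by rewrite -mulN1r; exact: ideal_mull. Qed.

Lemma ideal_subr D a b : ideal D a -> ideal D b -> ideal D (a - b).
Proof. by move=> Da Db; apply: ideal_add => //; exact: ideal_opp. Qed.

Lemma ideal_mullr D r a s : ideal D a -> ideal D (r * a * s).
Proof. by move=> Da; apply/ideal_mulr/ideal_mull. Qed.

Lemma ideal_ind_closed D (Q : R -> Prop) :
  (forall a, D a -> Q a) -> Q 0 -> (forall a b, Q a -> Q b -> Q (a + b)) ->
  (forall r a, Q a -> Q (r * a)) -> (forall r a, Q a -> Q (a * r)) ->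
  forall a, ideal D a -> Q a.
Proof.
move=> base Q0 QD Ql Qr a; elim=> {a} // [a b _ Qa _ Qb|r a _ _ /Ql//|r a _ _ /Qr//].
exact: QD.
Qed.

Lemma ideal_mono D D' : (forall a, D a -> ideal D' a) ->
  forall a, ideal D a -> ideal D' a.
Proof.
move=> DD'; apply: ideal_ind_closed => // [|a b|r a|r a].
- exact: ideal0.
- exact: ideal_add.
- exact: ideal_mull.
- exact: ideal_mulr.
Qed.

Lemma ideal_in_sub (S T : R -> Prop) D D' :
  (forall r, S r -> T r) -> (forall a, D a -> ideal_in T D' a) ->
  forall a, ideal_in S D a -> ideal_in T D' a.
Proof.
move=> ST DD' a; elim=> {a} [a /DD'//||a b _ Da _ Db|r a /ST Tr _ Da|r a /ST Tr _ Da].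
- exact: id_0.
- exact: id_add.
- exact: id_mull.
- exact: id_mulr.
Qed.

Lemma ideal_union D1 D2 a : ideal (fun z => D1 z \/ D2 z) a ->
  exists b c, [/\ ideal D1 b, ideal D2 c & a = b + c].
Proof.
move: a; apply: ideal_ind_closed.
- move=> a [Da|Da]; first by exists a, 0; split; rewrite ?addr0 //;
    [exact: ideal_incl | exact: ideal0].
  by exists 0, a; split; rewrite ?add0r //; [exact: ideal0 | exact: ideal_incl].
- by exists 0, 0; split; rewrite ?add0r //; exact: ideal0.
- move=> a b [a1 [a2 [Da1 Da2 ->]]] [b1 [b2 [Db1 Db2 ->]]].
  by exists (a1 + b1), (a2 + b2); split; rewrite 1?addrACA //; exact: ideal_add.
- move=> r a [b [c [Db Dc ->]]]; exists (r * b), (r * c).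
  by rewrite mulrDr; split=> //; exact: ideal_mull.
- move=> r a [b [c [Db Dc ->]]]; exists (b * r), (c * r).
  by rewrite mulrDl; split=> //; exact: ideal_mulr.
Qed.

Lemma inverse_unique u v h : h * u = 1 -> u * v = 1 -> h = v.
Proof. by move=> hu uv; rewrite -[h]mulr1 -uv mulrA hu mul1r. Qed.

Lemma gen_group_incl G u : G u -> gen_group G u.
Proof. by move=> Gu; rewrite -[u]mulr1; apply: gg_mul => //; exact: gg_one. Qed.

Lemma gen_groupM G u v : gen_group G u -> gen_group G v -> gen_group G (u * v).
Proof.
move=> Gu Gv; elim: Gu => [|g a Gg _ IH|g h a Gg gh hg _ IH]; first by rewrite mul1r.
  by rewrite -mulrA; exact: gg_mul.
by rewrite -mulrA; apply: (gg_inv Gg gh hg).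
Qed.

Lemma gen_group_inv G : (forall g, G g -> is_unit_el g) ->
  forall u, gen_group G u -> exists v, [/\ u * v = 1, v * u = 1 & gen_group G v].
Proof.
move=> Gunit u; elim=> {u} [|g a Gg _ [b [ab ba Gb]]|g h a Gg gh hg _ [b [ab ba Gb]]].
- by exists 1; rewrite mulr1; split=> //; exact: gg_one.
- have [h [gh hg]] := Gunit g Gg; exists (b * h); split.
  + by rewrite mulrA -(mulrA g) ab mulr1.
  + by rewrite mulrA -(mulrA b) hg mulr1.
  + by apply: gen_groupM => //; rewrite -[h]mulr1; apply: (gg_inv Gg gh hg); exact: gg_one.
- exists (b * g); split.
  + by rewrite mulrA -(mulrA h) ab mulr1.
  + by rewrite mulrA -(mulrA b) gh mulr1.
  + by apply: gen_groupM => //; exact: gen_group_incl.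
Qed.

Lemma gen_group_sub G G' :
  (forall g, G g -> gen_group G' g) ->
  (forall g h, G g -> g * h = 1 -> h * g = 1 -> gen_group G' h) ->
  forall u, gen_group G u -> gen_group G' u.
Proof.
move=> GG' GG'V u; elim=> {u} [|g a Gg _ IH|g h a Gg gh hg _ IH].
- exact: gg_one.
- by apply: gen_groupM => //; exact: GG'.
- by apply: gen_groupM => //; exact: (GG'V g).
Qed.

(** Stands for membership in the image of the group in the quotient by [ideal D]; [h] may fail to be
    a unit, but its representative [eps] belongs to the group itself. *)
Definition coset_mod G D h := exists2 eps, gen_group G eps & ideal D (h - eps).

Lemma coset_mod_cong G D h h' : ideal D (h - h') -> coset_mod G D h' ->
  coset_mod G D h.
Proof.
move=> Dhh' [eps Geps Dh']; exists eps => //.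
by rewrite -(subrK h' h) -addrA; exact: ideal_add.
Qed.

(** The group element [del] approximating [t'] is invertible and also approximates [t], so [a] is
    congruent to [(a t) del^-1]. *)
Lemma coset_mod_cancel G D a t t' : (forall g, G g -> is_unit_el g) ->
  coset_mod G D (a * t) -> coset_mod G D t' -> ideal D (t - t') ->
  coset_mod G D a.
Proof.
move=> Gunit [eps Geps Dat] [del Gdel Dt'] Dtt'.
have [del' [dd' d'd Gdel']] := gen_group_inv Gunit Gdel.
exists (eps * del'); first exact: gen_groupM.
have -> : a - eps * del' = (a * t - eps) * del' - a * ((t - t') + (t' - del)) * del'.
  rewrite addrA subrK mulrBr !mulrBl opprB -(mulrA a del) dd' mulr1.
  by rewrite [RHS]addrC addrA subrK.
apply: ideal_subr; first exact: ideal_mulr.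
by apply/ideal_mullr/ideal_add.
Qed.

Lemma units_one_inverse D u v : u * v = 1 -> v * u = 1 ->
  ideal D (u - 1) -> ideal D (v - 1).
Proof.
move=> uv vu Du; have -> : v - 1 = - (v * (u - 1)) by rewrite mulrBr vu mulr1 opprB.
by apply/ideal_opp/ideal_mull.
Qed.

Lemma gen_group_cong1 G D : (forall g, G g -> ideal D (g - 1)) ->
  forall u, gen_group G u -> ideal D (u - 1).
Proof.
have mul1 a b : ideal D (a - 1) -> ideal D (b - 1) -> ideal D (a * b - 1).
  move=> Da Db; have -> : a * b - 1 = a * (b - 1) + (a - 1).
    by rewrite mulrBr mulr1 addrA subrK.
  by apply: ideal_add => //; exact: ideal_mull.
move=> GD u; elim=> {u} [|g a /GD Dg _ IH|g h a /GD Dg gh hg _ IH].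
- by rewrite subrr; exact: ideal0.
- exact: mul1.
- by apply: mul1 => //; exact: (units_one_inverse gh).
Qed.

Inductive add_span P : R -> Prop :=
  | span_incl a : P a -> add_span P a
  | span_0 : add_span P 0
  | span_add a b : add_span P a -> add_span P b -> add_span P (a + b).

Lemma add_span_sub P P' : (forall a, P a -> add_span P' a) ->
  forall a, add_span P a -> add_span P' a.
Proof.
move=> PP' a; elim=> {a} [a /PP'//||a b _ IHa _ IHb]; first exact: span_0.
exact: span_add.
Qed.

Lemma add_spanN P a : (forall b, P b -> P (- b)) -> add_span P a -> add_span P (- a).
Proof.
move=> PN; elim=> {a} [a /PN Pa||a b _ IHa _ IHb]; first exact: span_incl.
  by rewrite oppr0; exact: span_0.
by rewrite opprD; exact: span_add.
Qed.

Lemma add_spanM P P' P'' a b : (forall a b, P a -> P' b -> add_span P'' (a * b)) ->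
  add_span P a -> add_span P' b -> add_span P'' (a * b).
Proof.
move=> PM Pa Pb; elim: Pa => {a} [a Pa||a c _ IHa _ IHc].
- elim: Pb => {b} [b Pb||b c _ IHb _ IHc]; first exact: PM.
    by rewrite mulr0; exact: span_0.
  by rewrite mulrDr; exact: span_add.
- by rewrite mul0r; exact: span_0.
- by rewrite mulrDl; exact: span_add.
Qed.

Lemma add_span_sum P (I : finType) (F : I -> R) :
  (forall i, add_span P (F i)) -> add_span P (\sum_i F i).
Proof. by move=> PF; elim/big_ind: _ => //; [exact: span_0 | exact: span_add]. Qed.

End IdealsAndGroups.

(** * Matrix units in the Jacobian algebra *)

Section JacobianBasics.
Variables (K : fieldType) (A : algType K) (m : nat) (x y : 'I_m.+1 -> A).
Hypothesis rels : jac_rels x y.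
Local Notation n := (ord_max : 'I_m.+1).
Local Notation E := (Eelt x y).
Local Notation e := (eelt x y).
Local Notation sub := (subalg_gen x y).
Implicit Types (J : pred 'I_m.+1) (P D : A -> Prop) (i j : 'I_m.+1) (a b : A).

Lemma subalg1 J : sub J 1.
Proof. by rewrite -[1]scale1r; exact: sg_scal. Qed.

Lemma subalg0 J : sub J 0.
Proof. by rewrite -(scale0r (1 : A)); exact: sg_scal. Qed.

Lemma subalgN J a : sub J a -> sub J (- a).
Proof.
move=> Ja; rewrite -mulN1r; apply: sg_mul => //.
by rewrite -(scale1r (1 : A)) -scaleNr; exact: sg_scal.
Qed.

Lemma subalgX J a k : sub J a -> sub J (a ^+ k).
Proof.
move=> Ja; elim: k => [|k IH]; first by rewrite expr0; exact: subalg1.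
by rewrite exprS; exact: sg_mul.
Qed.

Lemma subalgE J s t i : J i -> sub J (E s t i).
Proof.
move=> Ji; apply: sg_add; last apply: subalgN;
  by apply: sg_mul; apply: subalgX; [exact: sg_x | exact: sg_y].
Qed.

Lemma subalg_sub J J' a : (forall i, J i -> J' i) -> sub J a -> sub J' a.
Proof.
move=> JJ'; elim=> {a} [k|i /JJ'|i /JJ'|a b _ IHa _ IHb|a b _ IHa _ IHb].
- exact: sg_scal.
- exact: sg_x.
- exact: sg_y.
- exact: sg_add.
- exact: sg_mul.
Qed.

Lemma subalg_comm J a b :
  (forall i, J i -> b * x i = x i * b /\ b * y i = y i * b) ->
  sub J a -> b * a = a * b.
Proof.
move=> Hb; elim=> {a} [k|i /Hb[]//|i /Hb[]//|a c _ IHa _ IHc|a c _ IHa _ IHc].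
- by rewrite mulr_algl mulr_algr.
- by rewrite mulrDr mulrDl IHa IHc.
- by rewrite mulrA IHa -mulrA IHc mulrA.
Qed.

Lemma subalg_disjoint_comm J J' a b : (forall i, J i -> ~~ J' i) ->
  sub J a -> sub J' b -> a * b = b * a.
Proof.
have [_ Hc] := rels.
move=> JJ' Ja; apply: subalg_comm => i J'i.
have ne k : J k -> k != i.
  by move=> Jk; apply: contraTneq J'i => <-; exact: JJ'.
by split; apply/esym; apply: subalg_comm Ja => k /ne ki; have [xy xx yy] := Hc _ _ ki;
  have [xy' _ _] := Hc _ _ (introN eqP (fun q => (negP ki) (introT eqP (esym q))));
  rewrite ?xx ?yy ?xy ?xy'.
Qed.

Lemma yx i : y i * x i = 1.
Proof. by have [] := rels. Qed.

Lemma eeltE i : e i = 1 - x i * y i.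
Proof. by rewrite /eelt /Eelt !expr0 !expr1 mulr1. Qed.

Lemma EeltE s t i : E s t i = x i ^+ s * e i * y i ^+ t.
Proof. by rewrite eeltE mulrBr mulrBl mulr1 /Eelt exprSr exprS !mulrA. Qed.

Lemma ye i : y i * e i = 0.
Proof. by rewrite eeltE mulrBr mulr1 mulrA yx mul1r subrr. Qed.

Lemma ex i : e i * x i = 0.
Proof. by rewrite eeltE mulrBl mul1r -mulrA yx mulr1 subrr. Qed.

Lemma ee i : e i * e i = e i.
Proof. by rewrite {2}eeltE mulrBr mulr1 mulrA ex mul0r subr0. Qed.

Lemma yxX i k : y i ^+ k * x i ^+ k = 1.
Proof.
elim: k => [|k IH]; first by rewrite !expr0 mulr1.
by rewrite exprSr exprS mulrA -(mulrA _ (y i)) yx mulr1.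
Qed.

Lemma xXE k s t i : x i ^+ k * E s t i = E (k + s) t i.
Proof. by rewrite !EeltE !mulrA -exprD. Qed.

Lemma EyX k s t i : E s t i * y i ^+ k = E s (t + k) i.
Proof. by rewrite !EeltE -!mulrA -exprD. Qed.

Lemma yXE_gt k s t i : (s < k)%N -> y i ^+ k * E s t i = 0.
Proof.
move=> sk; rewrite EeltE !mulrA -(subnK sk) addnS -addSn exprD -(mulrA _ (y i ^+ s)).
by rewrite yxX mulr1 exprSr -(mulrA _ (y i)) ye mulr0 mul0r.
Qed.

Lemma ExX_gt k s t i : (t < k)%N -> E s t i * x i ^+ k = 0.
Proof.
move=> tk; rewrite EeltE -!mulrA -(subnKC tk) addSnnS exprD (mulrA (y i ^+ t)).
by rewrite yxX mul1r exprS (mulrA (e i)) ex mul0r mulr0.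
Qed.

Lemma xE s t i : x i * E s t i = E s.+1 t i.
Proof. by rewrite -(expr1 (x i)) xXE. Qed.

Lemma Ey s t i : E s t i * y i = E s t.+1 i.
Proof. by rewrite -[in LHS](expr1 (y i)) EyX addn1. Qed.

Lemma yE0 t i : y i * E 0 t i = 0.
Proof. by rewrite -(expr1 (y i)) yXE_gt. Qed.

Lemma yES s t i : y i * E s.+1 t i = E s t i.
Proof. by rewrite -xE mulrA yx mul1r. Qed.

Lemma Ex0 s i : E s 0 i * x i = 0.
Proof. by rewrite -(expr1 (x i)) ExX_gt. Qed.

Lemma ExS s t i : E s t.+1 i * x i = E s t i.
Proof. by rewrite -Ey -mulrA yx mulr1. Qed.

Lemma EM s t u v i : E s t i * E u v i = if t == u then E s v i else 0.
Proof.
case: ltngtP => [tu|tu|->].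
- have -> : E u v i = x i ^+ u * E 0 v i by rewrite xXE addn0.
  by rewrite mulrA ExX_gt // mul0r.
- have -> : E s t i = E s 0 i * y i ^+ t by rewrite EyX add0n.
  by rewrite -mulrA yXE_gt // mulr0.
- rewrite !EeltE !mulrA -(mulrA _ (y i ^+ u)) yxX mulr1.
  by rewrite -(mulrA _ (e i) (e i)) ee.
Qed.

Lemma e_E i : e i = E 0 0 i.
Proof. by []. Qed.

(** Finite matrices in the index [i]. Bounding rows and columns by the same [M] lets [y i ^+ M] kill
    them from the left (for entries free of [i]) and [x i ^+ M] from the right, as the ring
    identities demand. *)
Definition mspan i P M := add_span (fun a =>
  exists b k l, [/\ P b, (k < M)%N, (l < M)%N & a = b * E k l i]).

Lemma mspan_le i P M M' a : (M <= M')%N -> mspan i P M a -> mspan i P M' a.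
Proof.
move=> MM'; apply: add_span_sub => {}a [b [k [l [Pb kM lM ->]]]].
by apply: span_incl; exists b, k, l; split=> //; [exact: leq_trans kM MM' | exact: leq_trans lM MM'].
Qed.

Lemma mspan_sub i P P' M a : (forall b, P b -> P' b) -> mspan i P M a -> mspan i P' M a.
Proof.
move=> PP'; apply: add_span_sub => {}a [b [k [l [/PP' Pb kM lM ->]]]].
by apply: span_incl; exists b, k, l.
Qed.

Lemma mspan_elt i P M b k l : P b -> (k < M)%N -> (l < M)%N -> mspan i P M (b * E k l i).
Proof. by move=> Pb kM lM; apply: span_incl; exists b, k, l. Qed.

Lemma mspan_yX i P M a : (forall b, P b -> sub (predC1 i) b) -> mspan i P M a ->
  y i ^+ M * a = 0.
Proof.
move=> Pi; elim=> {a} [a [b [k [l [/Pi ib kM lM ->]]]]||a b _ IHa _ IHb].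
- have yb : y i ^+ M * b = b * y i ^+ M.
    apply: (@subalg_disjoint_comm (pred1 i) (predC1 i)) => //.
      by move=> j /= /eqP ->; rewrite eqxx.
    by apply: subalgX; apply: sg_y => /=.
  by rewrite mulrA yb -mulrA yXE_gt // mulr0.
- by rewrite mulr0.
- by rewrite mulrDr IHa IHb addr0.
Qed.

Lemma mspan_xX i P M a : mspan i P M a -> a * x i ^+ M = 0.
Proof.
elim=> {a} [a [b [k [l [Pb kM lM ->]]]]||a b _ IHa _ IHb].
- by rewrite -mulrA ExX_gt // mulr0.
- by rewrite mul0r.
- by rewrite mulrDl IHa IHb addr0.
Qed.

Lemma mspanM i P P' P'' M a b : (forall b, P' b -> sub (predC1 i) b) ->
  (forall a b, P a -> P' b -> P'' (a * b)) ->
  mspan i P M a -> mspan i P' M b -> mspan i P'' M (a * b).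
Proof.
move=> P'i PM; apply: add_spanM => {}a {}b [a1 [k [l [Pa kM lM ->]]]].
move=> [b1 [k' [l' [P'b k'M l'M ->]]]].
have Eb : E k l i * b1 = b1 * E k l i.
  apply: (@subalg_disjoint_comm (pred1 i) (predC1 i)); last exact: P'i.
    by move=> j /= /eqP ->; rewrite eqxx.
  by apply: subalgE => /=.
rewrite mulrA -(mulrA a1) Eb mulrA -(mulrA (a1 * b1)) EM; case: eqP => _.
  by apply: mspan_elt => //; exact: PM.
by rewrite mulr0; exact: span_0.
Qed.

(** * Finite blocks are stable under multiplication by the generators *)

Section Absorb.
Variables (i : 'I_m.+1) (J J' : pred 'I_m.+1).
Hypotheses (nJi : ~~ J i) (J'J : forall k, J' k -> k = i \/ J k).

Lemma subalg_E_comm b s t : sub J b -> E s t i * b = b * E s t i.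
Proof.
move=> Jb; apply: (@subalg_disjoint_comm (pred1 i) J) => //.
  by move=> j /= /eqP ->.
by apply: subalgE => /=.
Qed.

Lemma subalg_x_comm b : sub J b -> x i * b = b * x i.
Proof.
move=> Jb; apply: (@subalg_disjoint_comm (pred1 i) J) => //.
  by move=> j /= /eqP ->.
by apply: sg_x => /=.
Qed.

Lemma subalg_y_comm b : sub J b -> y i * b = b * y i.
Proof.
move=> Jb; apply: (@subalg_disjoint_comm (pred1 i) J) => //.
  by move=> j /= /eqP ->.
by apply: sg_y => /=.
Qed.

Variable P : A -> Prop.
Hypotheses (PJ : forall b, P b -> sub J b)
  (PMl : forall r b, sub J r -> P b -> P (r * b))
  (PMr : forall r b, sub J r -> P b -> P (b * r)).

Lemma mspan_Ml_sub M r a : sub J r -> mspan i P M a -> mspan i P M (r * a).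
Proof.
move=> Jr; elim=> {a} [a [b [k [l [Pb kM lM ->]]]]||a b _ IHa _ IHb].
- by rewrite mulrA; apply: mspan_elt => //; exact: PMl.
- by rewrite mulr0; exact: span_0.
- by rewrite mulrDr; exact: span_add.
Qed.

Lemma mspan_Mr_sub M r a : sub J r -> mspan i P M a -> mspan i P M (a * r).
Proof.
move=> Jr; elim=> {a} [a [b [k [l [Pb kM lM ->]]]]||a b _ IHa _ IHb].
- by rewrite -mulrA subalg_E_comm // mulrA; apply: mspan_elt => //; exact: PMr.
- by rewrite mul0r; exact: span_0.
- by rewrite mulrDl; exact: span_add.
Qed.

Lemma mspan_x M a : mspan i P M a -> mspan i P M.+1 (x i * a).
Proof.
elim=> {a} [a [b [k [l [Pb kM lM ->]]]]||a b _ IHa _ IHb].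
- rewrite mulrA subalg_x_comm -?mulrA ?xE; last exact: PJ.
  by apply: mspan_elt => //; exact: ltnW.
- by rewrite mulr0; exact: span_0.
- by rewrite mulrDr; exact: span_add.
Qed.

Lemma mspan_y M a : mspan i P M a -> mspan i P M (y i * a).
Proof.
elim=> {a} [a [b [k [l [Pb kM lM ->]]]]||a b _ IHa _ IHb].
- rewrite mulrA subalg_y_comm -?mulrA; last exact: PJ.
  case: k kM => [|k] kM; first by rewrite yE0 mulr0; exact: span_0.
  by rewrite yES; apply: mspan_elt => //; exact: ltnW.
- by rewrite mulr0; exact: span_0.
- by rewrite mulrDr; exact: span_add.
Qed.

Lemma mspan_mulx M a : mspan i P M a -> mspan i P M (a * x i).
Proof.
elim=> {a} [a [b [k [l [Pb kM lM ->]]]]||a b _ IHa _ IHb].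
- rewrite -mulrA; case: l lM => [|l] lM; first by rewrite Ex0 mulr0; exact: span_0.
  by rewrite ExS; apply: mspan_elt => //; exact: ltnW.
- by rewrite mul0r; exact: span_0.
- by rewrite mulrDl; exact: span_add.
Qed.

Lemma mspan_muly M a : mspan i P M a -> mspan i P M.+1 (a * y i).
Proof.
elim=> {a} [a [b [k [l [Pb kM lM ->]]]]||a b _ IHa _ IHb].
- by rewrite -mulrA Ey; apply: mspan_elt => //; exact: ltnW.
- by rewrite mul0r; exact: span_0.
- by rewrite mulrDl; exact: span_add.
Qed.

Lemma mspan_Ml r M a : sub J' r -> mspan i P M a -> exists M', mspan i P M' (r * a).
Proof.
move=> J'r; elim: J'r M a => {r} [k|k /J'J Jk|k /J'J Jk|r s _ IHr _ IHs|r s _ IHr _ IHs] M a.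
- by exists M; apply: mspan_Ml_sub => //; exact: sg_scal.
- case: Jk => [->|Jk] Ha; first by exists M.+1; exact: mspan_x.
  by exists M; apply: mspan_Ml_sub => //; exact: sg_x.
- case: Jk => [->|Jk] Ha; first by exists M; exact: mspan_y.
  by exists M; apply: mspan_Ml_sub => //; exact: sg_y.
- move=> Ha; have [[M1 H1] [M2 H2]] := (IHr _ _ Ha, IHs _ _ Ha).
  exists (maxn M1 M2); rewrite mulrDl; apply: span_add.
    by apply: mspan_le H1; exact: leq_maxl.
  by apply: mspan_le H2; exact: leq_maxr.
- by move=> /IHs[M1 /IHr[M2 H2]]; exists M2; rewrite -mulrA.
Qed.

Lemma mspan_Mr r M a : sub J' r -> mspan i P M a -> exists M', mspan i P M' (a * r).
Proof.
move=> J'r; elim: J'r M a => {r} [k|k /J'J Jk|k /J'J Jk|r s _ IHr _ IHs|r s _ IHr _ IHs] M a.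
- by exists M; apply: mspan_Mr_sub => //; exact: sg_scal.
- case: Jk => [->|Jk] Ha; first by exists M; exact: mspan_mulx.
  by exists M; apply: mspan_Mr_sub => //; exact: sg_x.
- case: Jk => [->|Jk] Ha; first by exists M.+1; exact: mspan_muly.
  by exists M; apply: mspan_Mr_sub => //; exact: sg_y.
- move=> Ha; have [[M1 H1] [M2 H2]] := (IHr _ _ Ha, IHs _ _ Ha).
  exists (maxn M1 M2); rewrite mulrDr; apply: span_add.
    by apply: mspan_le H1; exact: leq_maxl.
  by apply: mspan_le H2; exact: leq_maxr.
- by move=> /IHr[M1 /IHs[M2 H2]]; exists M2; rewrite mulrA.
Qed.

End Absorb.

Lemma ideal_in_subalg J D a : (forall d, D d -> sub J d) ->
  ideal_in (sub J) D a -> sub J a.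
Proof.
move=> DJ; elim=> {a} [a /DJ//||a b _ Ja _ Jb|r a Jr _ Ja|r a Jr _ Ja].
- exact: subalg0.
- exact: sg_add.
- exact: sg_mul.
- exact: sg_mul.
Qed.

(** Multiplication by [x i] or [y i] shifts a matrix unit or kills it, and the generators in [J] act
    on the coefficients; a finite block stays finite, though its size may grow. *)
Lemma ideal_mspan i J J' D a : ~~ J i -> (forall k, J' k -> k = i \/ J k) ->
  (forall d, D d -> sub J d) ->
  ideal_in (sub J') (fun z => exists2 d, D d & z = d * e i) a ->
  exists M, mspan i (ideal_in (sub J) D) M a.
Proof.
move=> nJi J'J DJ.
have PJ b : ideal_in (sub J) D b -> sub J b by exact: ideal_in_subalg.
elim=> {a} [a [d Dd ->]||a b _ [M1 Ha] _ [M2 Hb]|r a J'r _ [M Ha]|r a J'r _ [M Ha]].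
- by exists 1%N; rewrite e_E; apply: mspan_elt => //; exact: id_base.
- by exists 0%N; exact: span_0.
- exists (maxn M1 M2); apply: span_add.
    by apply: mspan_le Ha; exact: leq_maxl.
  by apply: mspan_le Hb; exact: leq_maxr.
- by apply: (@mspan_Ml i J J') Ha => //; exact: id_mull.
- by apply: (@mspan_Mr i J J') Ha => //; exact: id_mulr.
Qed.

Definition dspan j P M := add_span (fun a => exists b s t k l,
  [/\ P b, (s < M)%N && (t < M)%N, (k < M)%N, (l < M)%N & a = b * E s t j * E k l n]).

Lemma dspan_le j P M M' a : (M <= M')%N -> dspan j P M a -> dspan j P M' a.
Proof.
move=> MM'; apply: add_span_sub => {}a [b [s [t [k [l [Pb /andP[sM tM] kM lM ->]]]]]].
apply: span_incl; exists b, s, t, k, l.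
by split; rewrite ?(leq_trans sM MM') ?(leq_trans tM MM') ?(leq_trans kM MM') ?(leq_trans lM MM').
Qed.

(** The block decomposition is used twice: at [n], with entries in the ideal of the [d * e j] in the
    subalgebra without [n], and then at [j] on each entry. *)
Lemma ideal_dspan j D a : j != n -> (forall d, D d -> SC x y [set j; n] d) ->
  (forall b, sub predT b) ->
  ideal (fun z => exists2 d, D d & z = d * e j * e n) a ->
  exists M, dspan j (ideal_in (SC x y [set j; n]) D) M a.
Proof.
move=> jn DJ gen Ha.
pose D' z := exists2 d, D d & z = d * e j.
have D'J z : D' z -> Snm1 x y z.
  case=> d /DJ Jd ->; apply: sg_mul; last by rewrite e_E; exact: subalgE.
  by apply: subalg_sub Jd => k; rewrite !inE negb_or => /andP[].
have [M] : exists M, mspan n (ideal_in (Snm1 x y) D') M a.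
  apply: (@ideal_mspan n _ predT) => //; first by rewrite eqxx.
    by move=> k _; case: (eqVneq k n) => [->|]; [left | right].
  apply: ideal_in_sub Ha; first by move=> r _; exact: gen.
  move=> z [d Dd ->]; apply: id_base; exists (d * e j) => //.
  by exists d.
elim=> {a Ha} [a [b [k [l [Pb kM lM ->]]]]||a b _ [M1 Ha] _ [M2 Hb]].
- have [M'] : exists M, mspan j (ideal_in (SC x y [set j; n]) D) M b.
    apply: (@ideal_mspan j _ (fun k => k != n)) => //; first by rewrite !inE eqxx.
    by move=> k0 k0n; rewrite !inE; case: (eqVneq k0 j) => [->|]; [left | right].
  elim=> {b Pb} [b [c [s [t [Pc sM tM ->]]]]||b c _ [M1 Hb] _ [M2 Hc]].
  + exists (maxn M M'); apply: span_incl; exists c, s, t, k, l.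
    by rewrite !leq_max sM tM kM lM !orbT.
  + by exists 0%N; rewrite mul0r; exact: span_0.
  + exists (maxn M1 M2); rewrite mulrDl; apply: span_add.
      by apply: dspan_le Hb; exact: leq_maxl.
    by apply: dspan_le Hc; exact: leq_maxr.
- by exists 0%N; exact: span_0.
- exists (maxn M1 M2); apply: span_add.
    by apply: dspan_le Ha; exact: leq_maxl.
  by apply: dspan_le Hb; exact: leq_maxr.
Qed.

End JacobianBasics.

(** * Vaserstein's identity in the relative elementary group *)

Section RelativeElementary.
Variables (K : fieldType) (A : algType K) (m : nat) (x y : 'I_m.+1 -> A).
Hypothesis rels : jac_rels x y.
Local Notation n := (ord_max : 'I_m.+1).
Local Notation E := (Eelt x y).
Local Notation e := (eelt x y).
Local Notation sub := (subalg_gen x y).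
Local Notation Sn1 := (Snm1 x y).
Implicit Types (J : pred 'I_m.+1) (P D : A -> Prop) (i j : 'I_m.+1) (a b : A).

Lemma Snm1_E_comm a k l : Sn1 a -> E k l n * a = a * E k l n.
Proof. by apply: (subalg_E_comm rels) => /=; rewrite eqxx. Qed.

Lemma offdiag_mul0 a b k l : Sn1 b -> k != l -> a * E k l n * (b * E k l n) = 0.
Proof.
move=> Sb kl; rewrite mulrA -(mulrA a) Snm1_E_comm // mulrA -(mulrA (a * b)).
by rewrite (EM rels) eq_sym (negPf kl) mulr0.
Qed.

Lemma square_zero_inverse (R : pzRingType) (z : R) : z * z = 0 ->
  (1 + z) * (1 - z) = 1 /\ (1 - z) * (1 + z) = 1.
Proof.
by move=> zz; rewrite mulrDl mulrBl !mul1r mulrBr mulrDr !mulr1 zz subr0 addr0 subrK addrK.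
Qed.

Definition rel_gen (S : {set 'I_m.+1}) u := exists g h a (k l : nat),
  [/\ Einf_nm1 x y g, g * h = 1 /\ h * g = 1, pS x y S a, k != l
    & u = g * (1 + a * E k l n) * h].

Lemma elem_gen_inv a k l : Sn1 a -> k != l ->
  (1 + a * E k l n) * (1 - a * E k l n) = 1 /\
  (1 - a * E k l n) * (1 + a * E k l n) = 1.
Proof. by move=> Sa kl; apply: square_zero_inverse; exact: offdiag_mul0. Qed.

(** The factor [y n ^+ M] moves all columns beyond the rows, so every term becomes off-diagonal and
    products of two such blocks vanish: [1 + w y^M] turns sums in [w] into products. *)
Lemma span_upper (G : A -> Prop) P M w : (forall a, P a -> Sn1 a) ->
  (forall a k l, P a -> k != l -> gen_group G (1 + a * E k l n)) ->
  mspan x y n P M w -> gen_group G (1 + w * y n ^+ M).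
Proof.
move=> PS PG Pw; elim: (Pw) => {w Pw} [w [a [k [l [Pa kM lM ->]]]]||v w Pv IHv Pw IHw].
- rewrite -mulrA EyX; apply: PG => //.
  by rewrite neq_ltn (leq_trans kM) // leq_addl.
- by rewrite mul0r addr0; exact: gg_one.
- have -> : 1 + (v + w) * y n ^+ M = (1 + v * y n ^+ M) * (1 + w * y n ^+ M).
    rewrite [RHS]mulrDr mulr1 [(1 + _) * _]mulrDl mul1r -(mulrA v) (mulrA _ w).
    by rewrite (mspan_yX rels _ Pw) // mul0r mulr0 addr0 mulrDl addrA.
  exact: gen_groupM.
Qed.

Lemma span_lower (G : A -> Prop) P M w : (forall a, P a -> Sn1 a) ->
  (forall a k l, P a -> k != l -> gen_group G (1 + a * E k l n)) ->
  mspan x y n P M w -> gen_group G (1 + x n ^+ M * w).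
Proof.
move=> PS PG Pw; elim: (Pw) => {w Pw} [w [a [k [l [Pa kM lM ->]]]]||v w Pv IHv Pw IHw].
- have xa : x n ^+ M * a = a * x n ^+ M.
    apply: (@subalg_disjoint_comm _ _ _ _ _ rels (pred1 n) (predC1 n)).
    + by move=> j /= /eqP ->; rewrite eqxx.
    + by apply: subalgX; apply: sg_x => /=.
    + exact: PS.
  rewrite mulrA xa -mulrA xXE; apply: PG => //.
  by rewrite eq_sym neq_ltn (leq_trans lM) // leq_addr.
- by rewrite mulr0 addr0; exact: gg_one.
- have -> : 1 + x n ^+ M * (v + w) = (1 + x n ^+ M * v) * (1 + x n ^+ M * w).
    rewrite [RHS]mulrDr mulr1 [(1 + _) * _]mulrDl mul1r -(mulrA _ v) (mulrA v).
    by rewrite (mspan_xX rels Pv) mul0r mulr0 addr0 mulrDr addrA.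
  exact: gen_groupM.
Qed.

Lemma Einf_upper M w : mspan x y n Sn1 M w -> Einf_nm1 x y (1 + w * y n ^+ M).
Proof. by apply: span_upper => // a k l Sa kl; apply: gen_group_incl; exists a, k, l. Qed.

(** This element telescopes to the sum of the [E k k n] with [k < M], the identity of the block. *)
Lemma block_unit M : mspan x y n Sn1 M (1 - x n ^+ M * y n ^+ M).
Proof.
elim: M => [|M IH]; first by rewrite !expr0 mulr1 subrr; exact: span_0.
have -> : 1 - x n ^+ M.+1 * y n ^+ M.+1 = (1 - x n ^+ M * y n ^+ M) + 1 * E M M n.
  by rewrite mul1r /Eelt addrA subrK.
apply: span_add; first exact: (mspan_le (leqnSn M)).
by apply: mspan_elt => //; exact: subalg1.
Qed.

Section Relative.
Variable S : {set 'I_m.+1}.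
Hypothesis nS : n \notin S.

Lemma pS_Snm1 a : pS x y S a -> Sn1 a.
Proof.
apply: ideal_in_subalg => d [i iS]; apply: ideal_in_subalg => _ ->.
rewrite e_E; apply: subalgE.
by apply: contraNneq nS => <-.
Qed.

Lemma rel_gen_unit u : rel_gen S u -> is_unit_el u.
Proof.
case=> g [h [a [k [l [_ [gh hg] /pS_Snm1 Sa kl ->]]]]].
have [p1 p2] := elem_gen_inv Sa kl.
exists (g * (1 - a * E k l n) * h); split.
  by rewrite -!mulrA (mulrA h) hg mul1r (mulrA (1 + _)) p1 mul1r.
by rewrite -!mulrA (mulrA h) hg mul1r (mulrA (1 - _)) p2 mul1r.
Qed.

Lemma Erel_incl a k l : pS x y S a -> k != l -> Erel x y S (1 + a * E k l n).
Proof.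
move=> Sa kl; apply: gen_group_incl; exists 1, 1, a, k, l.
by rewrite !mul1r !mulr1; split=> //; exact: gg_one.
Qed.

Lemma ErelM u v : Erel x y S u -> Erel x y S v -> Erel x y S (u * v).
Proof. exact: gen_groupM. Qed.

Lemma Erel_conj g h u : Einf_nm1 x y g -> g * h = 1 -> h * g = 1 ->
  Erel x y S u -> Erel x y S (g * u * h).
Proof.
move=> Eg gh hg.
have conjM a b : g * (a * b) * h = g * a * h * (g * b * h).
  by rewrite -!mulrA (mulrA h) hg mul1r.
have genJ r : rel_gen S r -> rel_gen S (g * r * h).
  case=> g1 [h1 [a [k [l [Eg1 [gh1 hg1] Sa kl ->]]]]].
  exists (g * g1), (h1 * h), a, k, l; split=> //.
  - exact: gen_groupM.
  - by split; rewrite -!mulrA [X in _ * X]mulrA ?gh1 ?hg mul1r.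
  - by rewrite !mulrA.
elim=> {u} [|r u /genJ Gr _ IH|r s u /genJ Gr rs sr _ IH].
- by rewrite mulr1 gh; exact: gg_one.
- by rewrite conjM; exact: gg_mul.
- by rewrite conjM; apply: (gg_inv Gr) => //; rewrite -conjM ?rs ?sr mulr1 gh.
Qed.

Lemma pS_Ml a b : Sn1 a -> pS x y S b -> pS x y S (a * b).
Proof. exact: id_mull. Qed.

Lemma pS_Mr a b : pS x y S a -> Sn1 b -> pS x y S (a * b).
Proof. by move=> Sa Sb; exact: id_mulr. Qed.

Lemma pS_N a : pS x y S a -> pS x y S (- a).
Proof. by move=> Sa; rewrite -mulN1r; apply: pS_Ml => //; apply/subalgN/subalg1. Qed.

Lemma mspanN P M w : (forall a, P a -> P (- a)) ->
  mspan x y n P M w -> mspan x y n P M (- w).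
Proof.
move=> PN; apply: add_spanN => a [b [k [l [Pb kM lM ->]]]].
by exists (- b), k, l; rewrite mulNr; split=> //; exact: PN.
Qed.

Lemma mspan_mul_Sp M v w : mspan x y n Sn1 M v -> mspan x y n (pS x y S) M w ->
  mspan x y n (pS x y S) M (v * w).
Proof. by apply: (mspanM rels); [exact: pS_Snm1 | exact: pS_Ml]. Qed.

Lemma mspan_mul_pS M v w : mspan x y n (pS x y S) M v -> mspan x y n Sn1 M w ->
  mspan x y n (pS x y S) M (v * w).
Proof. by apply: (mspanM rels) => //; exact: pS_Mr. Qed.

Lemma mspan_pS M w : mspan x y n (pS x y S) M w -> mspan x y n Sn1 M w.
Proof. by apply: mspan_sub => b; exact: pS_Snm1. Qed.

Lemma Erel_upper M w : mspan x y n (pS x y S) M w -> Erel x y S (1 + w * y n ^+ M).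
Proof. by apply: span_upper; [exact: pS_Snm1 | exact: Erel_incl]. Qed.

Lemma Erel_lower M w : mspan x y n (pS x y S) M w -> Erel x y S (1 + x n ^+ M * w).
Proof. by apply: span_lower; [exact: pS_Snm1 | exact: Erel_incl]. Qed.

Lemma vaserstein D M v w z' :
  mspan x y n Sn1 M v -> mspan x y n (pS x y S) M w -> mspan x y n (pS x y S) M z' ->
  ideal D ((1 + v * w) * (1 + z') - 1) -> ideal D ((1 + z') * (1 + v * w) - 1) ->
  coset_mod (rel_gen S) D
    ((1 + v * w) * (1 - x n ^+ M * (w * (1 + z') * v) * y n ^+ M)).
Proof.
move=> Sv Sw Sz D1 D2.
set X := x n ^+ M; set Y := y n ^+ M.
have YX : Y * X = 1 by exact: yxX.
have Yv : Y * v = 0 by apply: (mspan_yX rels) Sv.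
have Yz : Y * z' = 0 by apply: (mspan_yX rels) (mspan_pS Sz).
have wX : w * X = 0 by apply: (mspan_xX rels) Sw.
have zX : z' * X = 0 by apply: (mspan_xX rels) Sz.
have W := vaserstein_word YX Yv Yz wX zX.
exists ((1 - X * (w + w * z')) * (1 + v * Y) * (1 + X * w) * (1 - (v + z' * v) * Y)); last first.
  rewrite W -addrA -opprD subKr; apply: ideal_add; first by apply/ideal_mulr/ideal_mulr.
  by apply/ideal_mulr/ideal_mull.
(* Only [w] and [z'] are assumed to have entries in the ideal, so [1 + v Y] is merely elementary.
   Splitting the last factor pairs it with its inverse, and the word becomes a conjugate of a
   relative element between two relative elements. *)
have -> : 1 - (v + z' * v) * Y = (1 - v * Y) * (1 - z' * v * Y).
  rewrite mulrBr mulr1 (mulrBl (z' * v * Y)) mul1r -(mulrA v) (mulrA Y).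
  by rewrite (mulrA Y) Yz !mul0r mulr0 subr0 mulrDl opprD addrA.
have vYvY : v * Y * (v * Y) = 0 by rewrite -mulrA (mulrA Y) Yv mul0r mulr0.
have [p1 p2] := square_zero_inverse vYvY.
have -> : (1 - X * (w + w * z')) * (1 + v * Y) * (1 + X * w) *
    ((1 - v * Y) * (1 - z' * v * Y)) =
  (1 + X * - (w + w * z')) * ((1 + v * Y) * (1 + X * w) * (1 - v * Y))
    * (1 + - (z' * v) * Y).
  by rewrite mulrN mulNr !mulrA.
apply: ErelM; first apply: ErelM.
- apply/Erel_lower/mspanN; first exact: pS_N.
  by apply: span_add => //; apply: mspan_mul_pS => //; exact: mspan_pS.
- by apply: Erel_conj => //; [exact: Einf_upper | exact: Erel_lower].
- apply/Erel_upper/mspanN; first exact: pS_N.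
  exact: mspan_mul_pS.
Qed.

(* Applying Vaserstein's identity to (v, w) and to (block unit, wv) produces the
   same shifted factor, which cancels. *)
Lemma vaserstein_swap D M v w z' :
  mspan x y n Sn1 M v -> mspan x y n (pS x y S) M w -> mspan x y n (pS x y S) M z' ->
  ideal D ((1 + v * w) * (1 + z') - 1) -> ideal D ((1 + z') * (1 + v * w) - 1) ->
  coset_mod (rel_gen S) D ((1 + v * w) * (1 - w * (1 + z') * v)).
Proof.
move=> Sv Sw Sz D1 D2.
have C1 := vaserstein Sv Sw Sz D1 D2.
set X := x n ^+ M in C1 *; set Y := y n ^+ M in C1 *.
set g := 1 - X * Y.
have gM a : mspan x y n Sn1 M a -> g * a = a.
  by move=> Sa; rewrite /g mulrBl mul1r -mulrA (mspan_yX rels _ Sa) // mulr0 subr0.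
have Mg a : mspan x y n Sn1 M a -> a * g = a.
  by move=> Sa; rewrite /g mulrBr mulr1 mulrA (mspan_xX rels Sa) // mul0r subr0.
have Swv : mspan x y n (pS x y S) M (w * v) by exact: mspan_mul_pS.
have Swz : mspan x y n (pS x y S) M (w * (1 + z')).
  rewrite mulrDr mulr1; apply: span_add => //.
  by apply: mspan_mul_pS => //; exact: mspan_pS.
have Swzv : mspan x y n (pS x y S) M (- (w * (1 + z') * v)).
  by apply: mspanN; [exact: pS_N | exact: mspan_mul_pS].
have gwv : g * (w * v) = w * v by apply/gM/mspan_pS.
have I1 : ideal D ((1 + w * v) * (1 - w * (1 + z') * v) - 1).
  by rewrite swap_inverse_l; apply/ideal_opp/ideal_mullr.
have I2 : ideal D ((1 - w * (1 + z') * v) * (1 + w * v) - 1).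
  by rewrite swap_inverse_r; apply/ideal_opp/ideal_mullr.
have C2 := @vaserstein D M g (w * v) (- (w * (1 + z') * v)) (block_unit M) Swv Swzv.
rewrite gwv in C2; have {C2} := C2 I1 I2.
rewrite (Mg (w * v * _)); last first.
  apply: mspan_pS; rewrite mulrBr mulr1 -mulrN; apply: span_add => //.
  by apply: mspan_mul_pS => //; exact: mspan_pS.
rewrite swap_shift -/X -/Y => C2.
apply: (coset_mod_cancel rel_gen_unit _ C2
  (t := (1 + w * v) * (1 - X * (w * (1 + z') * v) * Y))).
  apply: coset_mod_cong C1.
  rewrite -mulrA (mulrA (1 - w * (1 + z') * v)) -mulrBr; apply: ideal_mull.
  by rewrite -[X in _ - X]mul1r -mulrBl; exact: ideal_mulr.
rewrite -mulrBr; apply: ideal_mull.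
set p := w * (1 + z') * v; set q := w * _ * v.
have -> : 1 - X * p * Y - (1 - X * (p - q) * Y) = - (X * q * Y).
  by rewrite mulrBr mulrBl opprB !addrA subrK addrAC subrr sub0r.
by apply/ideal_opp/ideal_mullr/ideal_mullr.
Qed.

End Relative.
End RelativeElementary.

(** * The swindle *)

Section Swindle.
Variables (K : fieldType) (A : algType K) (m : nat) (x y : 'I_m.+1 -> A).
Hypothesis rels : jac_rels x y.
Local Notation n := (ord_max : 'I_m.+1).
Local Notation E := (Eelt x y).
Local Notation e := (eelt x y).
Local Notation sub := (subalg_gen x y).
Local Notation Sn1 := (Snm1 x y).
Variable j : 'I_m.+1.
Hypothesis jn : j != n.
Local Notation SCj := (SC x y [set j; n]).

Lemma SCj_Sn1 a : SCj a -> Sn1 a.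
Proof. by apply: subalg_sub => k; rewrite !inE negb_or => /andP[]. Qed.

Lemma SCj_predC1 a : SCj a -> sub (predC1 j) a.
Proof. by apply: subalg_sub => k; rewrite !inE negb_or => /andP[]. Qed.

Lemma mspan_subalg (J : pred 'I_m.+1) (P : A -> Prop) M a :
  J n -> (forall b, P b -> sub J b) -> mspan x y n P M a -> sub J a.
Proof.
move=> Jn PJ; elim=> {a} [a [b [k [l [/PJ Jb _ _ ->]]]]||a b _ Ja _ Jb].
- by apply: sg_mul => //; exact: subalgE.
- exact: subalg0.
- exact: sg_add.
Qed.

Lemma mspan_commj (P : A -> Prop) M a : (forall b, P b -> SCj b) ->
  mspan x y n P M a -> sub (predC1 j) a.
Proof.
move=> PJ; apply: mspan_subalg => [/=|b /PJ]; first by rewrite eq_sym.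
exact: SCj_predC1.
Qed.

Lemma e_comm a : sub (predC1 j) a -> e j * a = a * e j.
Proof.
by move=> Ja; rewrite e_E; apply: (subalg_E_comm rels) Ja => /=; rewrite eqxx.
Qed.

Lemma block_unitl M a : mspan x y n Sn1 M a -> (1 - x n ^+ M * y n ^+ M) * a = a.
Proof.
by move=> Sa; rewrite mulrBl mul1r -mulrA (mspan_yX rels _ Sa) // mulr0 subr0.
Qed.

Lemma block_unitr M a : mspan x y n Sn1 M a -> a * (1 - x n ^+ M * y n ^+ M) = a.
Proof.
by move=> Sa; rewrite mulrBr mulr1 mulrA (mspan_xX rels Sa) // mul0r subr0.
Qed.

Lemma shift_conj M d : sub (predC1 j) d -> mspan x y n Sn1 M d ->
  x j * d * (y j * (1 - x n ^+ M * y n ^+ M)) = d * (x j * y j).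
Proof.
move=> Jd Sd; have nj : ~~ predC1 j j by rewrite /= eqxx.
rewrite mulrA -(mulrA _ d) -(subalg_y_comm rels nj Jd) -!mulrA (block_unitr Sd).
by rewrite (subalg_y_comm rels nj Jd) mulrA (subalg_x_comm rels nj Jd) mulrA.
Qed.

Section Step.
Variables (S : {set 'I_m.+1}) (D : A -> Prop).
Hypothesis nS : n \notin S.

(* Taking v = y_j and w = x_j c in the swap lemma trades 1 + c for
   1 + c x_j y_j = (1 + c) - c e_j. *)
Lemma swindle (P : A -> Prop) M c c' :
  (forall b, P b -> SCj b) -> (forall b, P b -> pS x y S b) ->
  mspan x y n P M c -> mspan x y n P M c' ->
  ideal D ((1 + c) * (1 + c') - 1) -> ideal D ((1 + c') * (1 + c) - 1) ->
  coset_mod (rel_gen x y S) D (1 + c * e j).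
Proof.
move=> PJ PS Pc Pc' D1 D2.
have jSn : Sn1 (x j) /\ Sn1 (y j) by split; [exact: sg_x | exact: sg_y].
case: jSn => xS yS.
(* Multiplication by the block unit cuts [y j] down to a finite matrix in the index [n] without
   changing its product with [x j * c]. *)
set g := 1 - x n ^+ M * y n ^+ M.
have Sc : mspan x y n (pS x y S) M c by exact: mspan_sub Pc.
have Sc' : mspan x y n (pS x y S) M c' by exact: mspan_sub Pc'.
have Sv : mspan x y n Sn1 M (y j * g).
  by apply: (@mspan_Ml_sub _ _ _ x y n _ _ _ M (y j) g yS (block_unit x y M)) => r b; exact: sg_mul.
have Sw : mspan x y n (pS x y S) M (x j * c).
  by apply: (@mspan_Ml_sub _ _ _ x y n (fun k => k != n)) => //; exact: id_mull.
have vw : y j * g * (x j * c) = c.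
  by rewrite -mulrA block_unitl ?mulrA ?(yx rels) ?mul1r //; exact: (mspan_pS nS Sw).
have := @vaserstein_swap _ _ _ x y rels S nS D M (y j * g) (x j * c) c' Sv Sw Sc'.
rewrite vw => /(_ D1 D2); apply: coset_mod_cong.
have Sd : mspan x y n Sn1 M (c * (1 + c')).
  apply: (mspan_pS nS); rewrite mulrDr mulr1; apply: span_add => //.
  by apply: (mspan_mul_pS rels) => //; exact: (mspan_pS nS).
have Jd : sub (predC1 j) (c * (1 + c')).
  apply: sg_mul; first exact: mspan_commj Pc.
  by apply: sg_add; [exact: subalg1 | exact: mspan_commj Pc'].
have -> : x j * c * (1 + c') * (y j * g) = c * (1 + c') * (1 - e j).
  by rewrite -(mulrA (x j)) shift_conj // eeltE subKr.
by rewrite -opprB; apply: ideal_opp; rewrite swindle_identity; apply: ideal_subr;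
  [exact: ideal_mulr | exact: ideal_mullr].
Qed.

End Step.
End Swindle.

(** * Moving blocks indexed by [j] and [n] into the corner of [e j] *)

Section Relocation.
Variables (K : fieldType) (A : algType K) (m : nat) (x y : 'I_m.+1 -> A).
Hypothesis rels : jac_rels x y.
Local Notation n := (ord_max : 'I_m.+1).
Local Notation E := (Eelt x y).
Local Notation e := (eelt x y).
Local Notation sub := (subalg_gen x y).
Local Notation Sn1 := (Snm1 x y).
Variable j : 'I_m.+1.
Hypothesis jn : j != n.
Local Notation SCj := (SC x y [set j; n]).

Definition bimat a s t k l : A := a * E s t j * E k l n.

Lemma bimatM a b s t k l s' t' k' l' : SCj b ->
  bimat a s t k l * bimat b s' t' k' l' =
  if (t == s') && (l == k') then bimat (a * b) s t' k l' else 0.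
Proof.
move=> Jb; rewrite /bimat.
have Enb : E k l n * (b * E s' t' j) = b * E s' t' j * E k l n.
  apply: (Snm1_E_comm rels); apply: sg_mul; first exact: SCj_Sn1 Jb.
  exact: subalgE.
have Ejb : E s t j * b = b * E s t j.
  by apply: (subalg_E_comm rels) Jb; rewrite !inE eqxx.
rewrite -(mulrA (a * E s t j)) (mulrA (E k l n)) Enb -(mulrA (b * _)) (EM rels).
rewrite (mulrA (a * _)) -(mulrA a) (mulrA (E s t j)) Ejb -(mulrA b) (EM rels).
by case: eqP => _ /=; [rewrite !mulrA; case: eqP => // _; rewrite mulr0 | rewrite !(mulr0, mul0r)].
Qed.

Lemma SCj1 : SCj 1. Proof. exact: subalg1. Qed.

Section Size.
Variable M0 : nat.
Local Notation I2 := ('I_M0 * 'I_M0)%type.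
Let rk (p : I2) : nat := enum_rank p.

(** A partial isometry: [reloc * reloc_adj] is the identity of the block of pairs (s, k) below [M0],
    and conjugation sends the index (s, k) to (0, rk (s, k)). The [j]-index is thus stored in the
    [n]-index and only the factor [e j] remains. *)
Definition reloc : A := \sum_(p : I2) bimat 1 p.1 0 p.2 (rk p).
Definition reloc_adj : A := \sum_(p : I2) bimat 1 0 p.1 (rk p) p.2.
(** Room for both the original [n]-indices and the ranks of pairs. *)
Definition reloc_size := maxn M0.+1 #|{: I2}|.

Lemma rk_lt p : (rk p < reloc_size)%N.
Proof. by rewrite leq_max ltn_ord orbT. Qed.

Lemma ord_lt_size (p : 'I_M0) : (p < reloc_size)%N.
Proof. by rewrite leq_max ltnS ltnW. Qed.

Lemma bimat_mspan M a s t k l : SCj a -> (k < M)%N -> (l < M)%N ->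
  mspan x y n Sn1 M (bimat a s t k l).
Proof.
move=> Ja kM lM; apply: mspan_elt => //; apply: sg_mul; first exact: SCj_Sn1 Ja.
exact: subalgE.
Qed.

Lemma reloc_mspan : mspan x y n Sn1 reloc_size reloc.
Proof.
apply: add_span_sum => p.
by apply: bimat_mspan; [exact: SCj1 | exact: ord_lt_size | exact: rk_lt].
Qed.

Lemma reloc_adj_mspan : mspan x y n Sn1 reloc_size reloc_adj.
Proof.
apply: add_span_sum => p.
by apply: bimat_mspan; [exact: SCj1 | exact: rk_lt | exact: ord_lt_size].
Qed.

Lemma reloc_adjM a (p : I2) t l : SCj a ->
  reloc_adj * bimat a p.1 t p.2 l = bimat a 0 t (rk p) l.
Proof.
move=> Ja; rewrite mulr_suml (eq_bigr (fun q => if q == p then bimat a 0 t (rk q) l else 0)).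
  by rewrite -big_mkcond big_pred1_eq.
by move=> q _; rewrite bimatM // mul1r !val_eqE -pair_eqE.
Qed.

Lemma relocM a (p : I2) t l : SCj a ->
  reloc * bimat a 0 t (rk p) l = bimat a p.1 t p.2 l.
Proof.
move=> Ja; rewrite mulr_suml
  (eq_bigr (fun q : I2 => if q == p then bimat a q.1 t q.2 l else 0)).
  by rewrite -big_mkcond big_pred1_eq.
by move=> q _; rewrite bimatM // mul1r eqxx /= val_eqE (inj_eq enum_rank_inj).
Qed.

Lemma mul_reloc a s k (p : I2) : SCj a ->
  bimat a s p.1 k p.2 * reloc = bimat a s 0 k (rk p).
Proof.
move=> Ja; rewrite mulr_sumr
  (eq_bigr (fun q : I2 => if q == p then bimat a s 0 k (rk q) else 0)).
  by rewrite -big_mkcond big_pred1_eq.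
move=> q _; rewrite bimatM; last exact: SCj1.
by rewrite mulr1 !val_eqE eq_sym (eq_sym p.2) -pair_eqE.
Qed.

Lemma relocK (P : A -> Prop) b : (forall a, P a -> SCj a) -> dspan x y j P M0 b ->
  reloc * (reloc_adj * b) = b.
Proof.
move=> PJ; elim=> {b} [b [a [s [t [k [l [/PJ Ja /andP[sM tM] kM lM ->]]]]]]||b c _ Hb _ Hc].
- have := reloc_adjM (Ordinal sM, Ordinal kM) t l Ja; rewrite /bimat /= => ->.
  exact: (relocM (Ordinal sM, Ordinal kM) t l Ja).
- by rewrite !mulr0.
- by rewrite !mulrDr Hb Hc.
Qed.

Lemma reloc_conj (P : A -> Prop) b : (forall a, P a -> SCj a) -> dspan x y j P M0 b ->
  exists2 c, mspan x y n P reloc_size c & reloc_adj * b * reloc = c * e j.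
Proof.
move=> PJ; elim=> {b} [b [a [s [t [k [l [Pa /andP[sM tM] kM lM ->]]]]]]||
  b b' _ [c Pc bc] _ [c' Pc' bc']].
- have Ja := PJ a Pa.
  have := reloc_adjM (Ordinal sM, Ordinal kM) t l Ja; rewrite {1}/bimat /= => ->.
  have := mul_reloc 0 (rk (Ordinal sM, Ordinal kM)) (Ordinal tM, Ordinal lM) Ja.
  rewrite /= => ->.
  exists (a * E (rk (Ordinal sM, Ordinal kM)) (rk (Ordinal tM, Ordinal lM)) n).
    by apply: mspan_elt Pa (rk_lt _) (rk_lt _).
  rewrite /bimat -!mulrA -e_E; congr (_ * _); apply/esym/(Snm1_E_comm rels).
  by rewrite e_E; exact: subalgE.
- by exists 0; [exact: span_0 | rewrite mulr0 !mul0r].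
- by exists (c + c'); [exact: span_add | rewrite mulrDr !mulrDl bc bc'].
Qed.

End Size.

Section Step.
Variables (S : {set 'I_m.+1}) (D : A -> Prop) (i : 'I_m.+1).
Hypotheses (nS : n \notin S) (iS : i \in S) (ij : i != j).
Hypothesis gen : forall a, sub predT a.
Hypothesis e_cancel : forall d, sub (predC1 j) d -> ideal D (d * e j) -> ideal D d.

Lemma dspan_mspan_pS (P : A -> Prop) M b : (forall a, P a -> pS x y S a) ->
  dspan x y j P M b -> mspan x y n (pS x y S) M b.
Proof.
move=> PS; apply: add_span_sub => {}b [a [s [t [k [l [/PS Sa _ kM lM ->]]]]]].
apply: mspan_elt => //; apply: id_mulr => //; exact: subalgE.
Qed.

Lemma triple_ideal_coset u u' b q : u * u' = 1 -> u' * u = 1 -> u - 1 = b + q ->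
  ideal (fun z => z = e i * e j * e n) b -> ideal D q ->
  coset_mod (rel_gen x y S) D u.
Proof.
move=> uu' u'u ub Ib Dq.
have u'b := one_sub_inverse u'u ub.
set b' := - u' * b in u'b; set q' := - (u' * q) in u'b.
have Ib' : ideal (fun z => z = e i * e j * e n) b' by exact: ideal_mull.
have Dq' : ideal D q' by apply/ideal_opp/ideal_mull.
have D1 : ideal D ((1 + b) * (1 + b') - 1).
  rewrite (inverse_up_to uu' ub u'b); apply: ideal_subr; last exact: ideal_mull.
  by apply/ideal_mulr/ideal_opp.
have D2 : ideal D ((1 + b') * (1 + b) - 1).
  rewrite (inverse_up_to u'u u'b ub); apply: ideal_subr; last exact: ideal_mull.
  by apply/ideal_mulr/ideal_opp.
have eiJ d : d = e i -> SCj d.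
  move=> ->; rewrite e_E; apply: subalgE; rewrite !inE negb_or ij /=.
  by apply: contraNneq nS => <-.
set P := ideal_in SCj (fun d => d = e i).
have PJ a : P a -> SCj a by exact: ideal_in_subalg.
have PS a : P a -> pS x y S a.
  apply: ideal_in_sub => [r|z zi]; first exact: SCj_Sn1.
  by apply: id_base; exists i => //; exact: id_base.
have genD z : ideal (fun z => z = e i * e j * e n) z -> exists M, dspan x y j P M z.
  move=> Iz; apply: (ideal_dspan rels) => //.
  by apply: ideal_mono Iz => _ ->; apply: ideal_incl; exists (e i).
have [M1 dB1] := genD _ Ib; have [M2 dB2] := genD _ Ib'.
pose M0 := maxn M1 M2.
have dB : dspan x y j P M0 b by apply: dspan_le dB1; exact: leq_maxl.
have dB' : dspan x y j P M0 b' by apply: dspan_le dB2; exact: leq_maxr.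
have [c Pc bc] := reloc_conj PJ dB; have [c' Pc' bc'] := reloc_conj PJ dB'.
set T := reloc M0 in bc bc'; set T' := reloc_adj M0 in bc bc'.
have TT' z : dspan x y j P M0 z -> T * (T' * z) = z by exact: relocK.
have Jc := mspan_commj jn PJ Pc; have Jc' := mspan_commj jn PJ Pc'.
(* Conjugation by [T] is multiplicative here because [T T'] acts as the identity on [f']; on the
   other side, [e j] is idempotent and commutes with [d']. *)
have conj (f f' d d' : A) : dspan x y j P M0 f' -> sub (predC1 j) d' ->
    T' * f * T = d * e j -> T' * f' * T = d' * e j ->
    ((1 + d) * (1 + d') - 1) * e j = T' * ((1 + f) * (1 + f') - 1) * T.
  move=> df' Jd' Hd Hd'.
  have expand (r s : A) : (1 + r) * (1 + s) - 1 = r + s + r * s.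
    by rewrite mulrDr mulr1 mulrDl mul1r addrC !addrA addNr add0r.
  rewrite !expand !(mulrDr T') !mulrDl Hd Hd'; congr (_ + _).
  rewrite -{1}(TT' _ df') -!mulrA (mulrA T') (mulrA (T' * f)) Hd (mulrA T') Hd'.
  by rewrite -mulrA (mulrA (e j)) (e_comm rels Jd') -mulrA (ee rels).
(* Invertibility of [1 + b] modulo [D] passes to the corner with a factor [e j], which [e_cancel]
   removes. *)
have C1 : ideal D ((1 + c) * (1 + c') - 1).
  apply: e_cancel; last by rewrite (conj _ _ _ _ dB' Jc' bc bc'); exact: ideal_mullr.
  by apply: sg_add; [apply: sg_mul; apply: sg_add | apply: subalgN] => //; exact: subalg1.
have C2 : ideal D ((1 + c') * (1 + c) - 1).
  apply: e_cancel; last by rewrite (conj _ _ _ _ dB Jc bc' bc); exact: ideal_mullr.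
  by apply: sg_add; [apply: sg_mul; apply: sg_add | apply: subalgN] => //; exact: subalg1.
(* The swap of [T] and [T' b] leaves the factor [1 - T' b (1 + b') T], congruent to [1 + c' e_j]
   because [b (1 + b')] is congruent to [- b']. Hence the swindle is needed for [c'], with [c] as
   its approximate inverse. *)
have swc := swindle rels jn nS PJ PS Pc' Pc C2 C1.
have size_le z : dspan x y j P M0 z -> mspan x y n (pS x y S) (reloc_size M0) z.
  move=> dz; apply: mspan_le (dspan_mspan_pS PS dz).
  by rewrite leq_max leqnSn.
have Sw : mspan x y n (pS x y S) (reloc_size M0) (T' * b).
  by apply: (mspan_mul_Sp rels nS (reloc_adj_mspan M0)); exact: size_le.
have := @vaserstein_swap _ _ _ x y rels S nS D _ T (T' * b) b'
  (reloc_mspan M0) Sw (size_le _ dB').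
rewrite (TT' _ dB) => /(_ D1 D2) C3.
have /(coset_mod_cong (h := u)) : coset_mod (rel_gen x y S) D (1 + b); last first.
  by apply; rewrite opprD addrA ub addrC addKr.
apply: (coset_mod_cancel (rel_gen_unit rels nS) C3 swc).
have -> : 1 - T' * b * (1 + b') * T - (1 + c' * e j) =
    - (T' * ((1 + b) * (1 + b') - 1) * T).
  rewrite -bc' opprD addrA (addrAC 1) subrr sub0r -opprD; congr (- _).
  rewrite -mulrDl; congr (_ * _); rewrite -mulrA -mulrDr; congr (_ * _).
  by rewrite [in RHS]mulrDl mul1r [RHS]addrC !addrA addNr add0r addrC.
exact/ideal_opp/ideal_mullr.
Qed.

End Step.
End Relocation.

(** * Action on sequences by shifts *)

Section SequenceEndomorphisms.
Variables (K : fieldType) (A : algType K).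

(** Sequences with values in [A] rather than [K], so that all generators except those of one chosen
    index can act by left multiplication. Linearity over [K] makes composition a [K]-algebra
    product, as the universal property demands. *)
Record seq_endo := SeqEndo {
  endo_fun :> (nat -> A) -> nat -> A;
  endo_add : forall u v k, endo_fun (fun i => u i + v i) k = endo_fun u k + endo_fun v k;
  endo_scale : forall c u k, endo_fun (fun i => c *: u i) k = c *: endo_fun u k }.

Lemma seq_endoP (f g : seq_endo) : (forall u k, f u k = g u k) -> f = g.
Proof.
case: f g => [f fD fZ] [g gD gZ] /= fg.
have {}fg : f = g by apply/funext => u; apply/funext => k.
by subst g; congr SeqEndo; exact: Prop_irrelevance.
Qed.

HB.instance Definition _ := gen_eqMixin seq_endo.
HB.instance Definition _ := gen_choiceMixin seq_endo.

Program Definition endo0 := @SeqEndo (fun _ _ => 0) _ _.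
Next Obligation. by rewrite addr0. Qed.
Next Obligation. by rewrite scaler0. Qed.

Program Definition endoD (f g : seq_endo) := @SeqEndo (fun u k => f u k + g u k) _ _.
Next Obligation. by rewrite !endo_add addrACA. Qed.
Next Obligation. by rewrite !endo_scale scalerDr. Qed.

Program Definition endoN (f : seq_endo) := @SeqEndo (fun u k => - f u k) _ _.
Next Obligation. by rewrite !endo_add opprD. Qed.
Next Obligation. by rewrite !endo_scale scalerN. Qed.

Program Definition endo1 := @SeqEndo (fun u k => u k) _ _.

Program Definition endoM (f g : seq_endo) := @SeqEndo (fun u => f (g u)) _ _.
Next Obligation.
by rewrite -endo_add; congr (endo_fun f _ k); apply/funext => i; rewrite endo_add.
Qed.
Next Obligation.
by rewrite -endo_scale; congr (endo_fun f _ k); apply/funext => i; rewrite endo_scale.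
Qed.

Program Definition endoZ (c : K) (f : seq_endo) := @SeqEndo (fun u k => c *: f u k) _ _.
Next Obligation. by rewrite !endo_add scalerDr. Qed.
Next Obligation. by rewrite !endo_scale !scalerA mulrC. Qed.

Fact endo_addA : associative endoD.
Proof. by move=> f g h; apply: seq_endoP => u k /=; rewrite addrA. Qed.
Fact endo_addC : commutative endoD.
Proof. by move=> f g; apply: seq_endoP => u k /=; rewrite addrC. Qed.
Fact endo_add0 : left_id endo0 endoD.
Proof. by move=> f; apply: seq_endoP => u k /=; rewrite add0r. Qed.
Fact endo_addN : left_inverse endo0 endoN endoD.
Proof. by move=> f; apply: seq_endoP => u k /=; rewrite addNr. Qed.

HB.instance Definition _ :=
  GRing.isZmodule.Build seq_endo endo_addA endo_addC endo_add0 endo_addN.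

Fact endo_mulA : associative endoM.
Proof. by move=> f g h; apply: seq_endoP. Qed.
Fact endo_mul1 : left_id endo1 endoM.
Proof. by move=> f; apply: seq_endoP. Qed.
Fact endo_mulr1 : right_id endo1 endoM.
Proof. by move=> f; apply: seq_endoP. Qed.
Fact endo_mulDl : left_distributive endoM +%R.
Proof. by move=> f g h; apply: seq_endoP. Qed.
Fact endo_mulDr : right_distributive endoM +%R.
Proof. by move=> f g h; apply: seq_endoP => u k /=; rewrite -endo_add. Qed.
Fact endo_1_neq0 : endo1 != 0.
Proof.
apply/eqP => /(congr1 (fun f : seq_endo => f (fun=> 1) 0%N)) /= /eqP.
by rewrite oner_eq0.
Qed.

HB.instance Definition _ := GRing.Zmodule_isNzRing.Build seq_endo
  endo_mulA endo_mul1 endo_mulr1 endo_mulDl endo_mulDr endo_1_neq0.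

Fact endo_scaleA a b f : endoZ a (endoZ b f) = endoZ (a * b) f.
Proof. by apply: seq_endoP => u k /=; rewrite scalerA. Qed.
Fact endo_scale1 : left_id 1 endoZ.
Proof. by move=> f; apply: seq_endoP => u k /=; rewrite scale1r. Qed.
Fact endo_scaleDr : right_distributive endoZ +%R.
Proof. by move=> a f g; apply: seq_endoP => u k /=; rewrite scalerDr. Qed.
Fact endo_scaleDl f : {morph endoZ^~ f : a b / a + b}.
Proof. by move=> a b; apply: seq_endoP => u k /=; rewrite scalerDl. Qed.

HB.instance Definition _ := GRing.Zmodule_isLmodule.Build K seq_endo
  endo_scaleA endo_scale1 endo_scaleDr endo_scaleDl.

Fact endo_scaleAl (a : K) (f g : seq_endo) : a *: (f * g) = (a *: f) * g.
Proof. by apply: seq_endoP. Qed.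
HB.instance Definition _ := GRing.Lmodule_isLalgebra.Build K seq_endo endo_scaleAl.

Fact endo_scaleAr (a : K) (f g : seq_endo) : a *: (f * g) = f * (a *: g).
Proof. by apply: seq_endoP => u k /=; rewrite -endo_scale. Qed.
HB.instance Definition _ := GRing.Lalgebra_isAlgebra.Build K seq_endo endo_scaleAr.

Program Definition endo_lmul (a : A) := @SeqEndo (fun u k => a * u k) _ _.
Next Obligation. by rewrite mulrDr. Qed.
Next Obligation. by rewrite scalerAr. Qed.

Program Definition endo_shift := @SeqEndo (fun u k => if k is k'.+1 then u k' else 0) _ _.
Next Obligation. by case: k => [|k] //; rewrite addr0. Qed.
Next Obligation. by case: k => [|k] //; rewrite scaler0. Qed.

Program Definition endo_unshift := @SeqEndo (fun u k => u k.+1) _ _.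

End SequenceEndomorphisms.

(** * Cancelling the idempotent [e j] modulo an ideal generated away from [j] *)

Section Cancellation.
Variables (K : fieldType) (A : algType K) (m : nat) (x y : 'I_m.+1 -> A).
Hypothesis jac : is_jacobian_algebra x y.
Local Notation e := (eelt x y).
Local Notation sub := (subalg_gen x y).
Variable j : 'I_m.+1.

Let rels : jac_rels x y. Proof. by case: jac. Qed.

Definition toeplitz_x i : seq_endo A := if i == j then endo_shift A else endo_lmul (x i).
Definition toeplitz_y i : seq_endo A := if i == j then endo_unshift A else endo_lmul (y i).

Lemma toeplitz_rels : jac_rels toeplitz_x toeplitz_y.
Proof.
have [yx Hc] := rels; rewrite /toeplitz_x /toeplitz_y; split=> [i|i k ik].
  by case: eqP => _; apply: seq_endoP => u k //=; rewrite mulrA yx mul1r.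
have [xy xx yy] := Hc _ _ ik.
case: (eqVneq i j) => [ij|_]; case: (eqVneq k j) => [kj|_].
- by rewrite ij kj eqxx in ik.
- by split; apply: seq_endoP => u [|l] //=; rewrite mulr0.
- by split; apply: seq_endoP => u [|l] //=; rewrite mulr0.
- by split; apply: seq_endoP => u l /=; rewrite !mulrA ?xy ?xx ?yy.
Qed.

(* Let x_j, y_j act on sequences in A as shifts and the other generators act by
   left multiplication: then [d * e j] sends the constant sequence 1 to
   (d, 0, 0, ...), and the ideal generated by [D] maps into sequences in it. *)
Lemma e_cancel (D : A -> Prop) d : (forall z, D z -> sub (predC1 j) z) ->
  sub (predC1 j) d -> ideal D (d * e j) -> ideal D d.
Proof.
move=> DJ Jd; have [_ [gen univ]] := jac.
have [f [fD fM fZ f1 fxy]] := univ _ _ _ toeplitz_rels.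
have f_lmul a : sub (predC1 j) a -> f a = endo_lmul a.
  elim=> {a} [k|i /negPf ij|i /negPf ij|a b _ IHa _ IHb|a b _ IHa _ IHb].
  - by rewrite fZ f1; apply: seq_endoP => u k0 /=; rewrite mulr_algl.
  - by rewrite (fxy i).1 /toeplitz_x ij.
  - by rewrite (fxy i).2 /toeplitz_y ij.
  - by rewrite fD IHa IHb; apply: seq_endoP => u k /=; rewrite mulrDl.
  - by rewrite fM IHa IHb; apply: seq_endoP => u k /=; rewrite mulrA.
have f_stable r u : (forall k, ideal D (u k)) -> forall k, ideal D (f r u k).
  elim: (gen r) u => {r} [c|i _|i _|a b _ IHa _ IHb|a b _ IHa _ IHb] u Du k.
  - by rewrite fZ f1 /= -mulr_algl; exact: ideal_mull.
  - rewrite (fxy i).1 /toeplitz_x; case: eqP => _ /=; last exact: ideal_mull.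
    by case: k => [|k]; [exact: ideal0 | exact: Du].
  - by rewrite (fxy i).2 /toeplitz_y; case: eqP => _ /=; [exact: Du | exact: ideal_mull].
  - by rewrite fD /=; apply: ideal_add; [exact: IHa | exact: IHb].
  - by rewrite fM /=; apply: IHa => l; exact: IHb.
(* A generator in [D] avoids [j], hence acts by left multiplication and puts every entry of any
   sequence into the ideal; left multiples are handled by [f_stable]. *)
have f_ideal q : ideal D q -> forall u k, ideal D (f q u k).
  move: q; apply: ideal_ind_closed => [z Dz u k||a b Ha Hb u k|r a Ha u k|r a Ha u k].
  - by rewrite f_lmul /=; [apply/ideal_mulr/ideal_incl | exact: DJ].
  - by move=> u k; rewrite f_lmul /= ?mul0r; [exact: ideal0 | exact: subalg0].
  - by rewrite fD /=; exact: ideal_add.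
  - by rewrite fM /=; apply: f_stable.
  - by rewrite fM /=.
move=> /f_ideal/(_ (fun=> 1) 0%N); rewrite fM f_lmul //= eeltE fD f1 /=.
rewrite -scaleN1r fZ fM /= (fxy j).1 (fxy j).2 /toeplitz_x eqxx /=.
by rewrite scaler0 addr0 mulr1.
Qed.

End Cancellation.

(** * Products of the ideals p_i *)

Section MonomialIdeals.
Variables (K : fieldType) (A : algType K) (m : nat) (x y : 'I_m.+1 -> A).
Hypothesis rels : jac_rels x y.
Hypothesis gen : forall a, subalg_gen x y predT a.
Local Notation n := (ord_max : 'I_m.+1).
Local Notation E := (Eelt x y).
Local Notation e := (eelt x y).
Local Notation sub := (subalg_gen x y).
Local Notation Sn1 := (Snm1 x y).
Implicit Types (i j k : 'I_m.+1) (a b c d q : A) (D : A -> Prop).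

Lemma subalg_e (J : pred 'I_m.+1) i : J i -> sub J (e i).
Proof. exact: (@subalgE _ _ _ x y J 0 0). Qed.

Lemma ee_comm i j : e i * e j = e j * e i.
Proof.
have [->//|ij] := eqVneq i j.
apply: (@subalg_disjoint_comm _ _ _ _ _ rels (pred1 i) (predC1 i)) => /=.
- by move=> k /= /eqP ->; rewrite eqxx.
- by apply: subalg_e => /=.
- by apply: subalg_e => /=; rewrite eq_sym.
Qed.

(** Expand [q] into terms [a E_kl(j)] with [a] free of [j]: since [d] and [a] commute with [x_j] and
    [e_j], each term of [d q] is [x_j^k (d e_j) a y_j^l]. *)
Lemma e_pid_mul j d q : sub (predC1 j) d -> pid x y j q ->
  ideal (fun z => z = d * e j) (d * q).
Proof.
move=> Jd jq.
have nj : ~~ predC1 j j by rewrite /= eqxx.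
have [M] : exists M, mspan x y j (ideal_in (sub (predC1 j)) (fun z => z = 1)) M q.
  apply: (@ideal_mspan _ _ _ _ _ rels j (predC1 j) predT) => //.
  - by move=> k _; case: (eqVneq k j) => [->|kj]; [left | right].
  - by move=> _ ->; exact: subalg1.
  - apply: ideal_in_sub jq => [r _|z ->]; first exact: gen.
    by apply: id_base; exists 1; rewrite ?mul1r.
elim=> {q jq} [q [a [k [l [Pa _ _ ->]]]]||q q' _ Hq _ Hq'].
- have Ja : sub (predC1 j) a by apply: ideal_in_subalg Pa => _ ->; exact: subalg1.
  have -> : d * (a * E k l j) = x j ^+ k * (d * e j) * (a * y j ^+ l).
    have xda : x j ^+ k * (d * a) = d * a * x j ^+ k.
      apply: (@subalg_disjoint_comm _ _ _ _ _ rels (pred1 j) (predC1 j)).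
      + by move=> k' /= /eqP ->.
      + by apply: subalgX; apply: sg_x => /=.
      + exact: sg_mul.
    rewrite EeltE !mulrA -xda -!mulrA; congr (_ * (_ * _)).
    by rewrite !mulrA (e_comm rels Ja).
  by apply/ideal_mullr/ideal_incl.
- by rewrite (mulr0 d); exact: ideal0.
- by rewrite (mulrDr d q); exact: ideal_add.
Qed.

Lemma ideal_pid_mul j d a q : sub (predC1 j) d -> ideal (fun z => z = d) a ->
  pid x y j q -> ideal (fun z => z = d * e j) (a * q).
Proof.
move=> Jd Ia; move: a Ia q; apply: ideal_ind_closed => [_ ->||a b Ha Hb|r a Ha|r a Ha] q jq.
- exact: e_pid_mul.
- by rewrite mul0r; exact: ideal0.
- by rewrite mulrDl; apply: ideal_add; [exact: Ha | exact: Hb].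
- by rewrite -mulrA; apply: ideal_mull; exact: Ha.
- by rewrite -mulrA; apply: Ha; exact: ideal_mull.
Qed.

Lemma y_comm i k : y i * y k = y k * y i.
Proof. by have [->//|ik] := eqVneq i k; have [_ /(_ _ _ ik)[]] := rels. Qed.

Lemma yprod_comm k (w : seq 'I_m.+1) :
  y k * (\prod_(i <- w) y i) = (\prod_(i <- w) y i) * y k.
Proof. by apply: commr_prod => i _; exact: y_comm. Qed.

Lemma yprod_yprod_comm (w w' : seq 'I_m.+1) :
  (\prod_(i <- w) y i) * (\prod_(i <- w') y i) =
  (\prod_(i <- w') y i) * (\prod_(i <- w) y i).
Proof. by apply: commr_prod => i _; rewrite /GRing.comm yprod_comm. Qed.

(** * Annihilation by words in the [y i], and intersections of ideals *)

Section LocalNilpotence.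
Variable T : pred 'I_m.+1.

Definition y_killed b := exists2 w, all T w & (\prod_(i <- w) y i) * b = 0.

Lemma y_killed_add a b : y_killed a -> y_killed b -> y_killed (a + b).
Proof.
move=> [w Tw wa] [w' Tw' w'b]; exists (w ++ w'); first by rewrite all_cat Tw.
rewrite big_cat /= mulrDr -[in X in _ + X]mulrA w'b mulr0 addr0.
by rewrite yprod_yprod_comm -mulrA wa mulr0.
Qed.

Lemma y_killed_mull r b : y_killed b -> y_killed (r * b).
Proof.
elim: (gen r) b => {r} [c|k _|k _|r s _ IHr _ IHs|r s _ IHr _ IHs] b.
- by case=> w Tw wb; exists w => //; rewrite mulr_algl -scalerAr wb scaler0.
- case=> w Tw wb; case Tk: (T k).
    (* The new letter goes last, next to [x k], where [y k * x k = 1] removes both. *)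
    exists (rcons w k); first by rewrite all_rcons Tk.
    by rewrite -cats1 big_cat big_seq1 -mulrA (mulrA (y k)) (yx rels) mul1r.
  exists w => //; rewrite mulrA.
  suff -> : (\prod_(i <- w) y i) * x k = x k * \prod_(i <- w) y i.
    by rewrite -mulrA wb mulr0.
  apply: (@subalg_disjoint_comm _ _ _ _ _ rels T (pred1 k)).
  + by move=> i Ti; apply: contraTneq Ti => ->; rewrite Tk.
  + elim: w Tw {wb} => [|i w IH] /=; first by rewrite big_nil => _; exact: subalg1.
    case/andP=> Ti /IH Tw; rewrite big_cons; apply: sg_mul => //; exact: sg_y.
  + by apply: sg_x => /=.
- by case=> w Tw wb; exists w => //; rewrite mulrA -yprod_comm -mulrA wb mulr0.
- by move=> kb; rewrite mulrDl; apply: y_killed_add; [exact: IHr | exact: IHs].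
- by move=> kb; rewrite -mulrA; apply/IHr/IHs.
Qed.

Lemma ideal_y_killed b : ideal (fun z => exists2 i, T i & z = e i) b -> y_killed b.
Proof.
move: b; apply: ideal_ind_closed.
- by move=> _ [i Ti ->]; exists [:: i]; rewrite /= ?Ti // big_seq1 (ye rels).
- by exists [::]; rewrite ?mulr0.
- exact: y_killed_add.
- exact: y_killed_mull.
- by move=> r a [w Tw wa]; exists w; rewrite // mulrA wa mul0r.
Qed.

(* [b = e i * b + x i * (y i * b)], so membership descends along a word in the
   [y i] that kills [b]. *)
Lemma ideal_absorb D (Q : A -> Prop) b :
  (forall i c, T i -> Q c -> Q (y i * c)) ->
  (forall i c, T i -> Q c -> ideal D (e i * c)) ->
  ideal (fun z => exists2 i, T i & z = e i) b -> Q b -> ideal D b.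
Proof.
move=> Qy Qe /ideal_y_killed[w Tw wb] Qb.
have : ideal D ((\prod_(i <- w) y i) * b) by rewrite wb; exact: ideal0.
elim: w Tw {wb} => [|i w IH] /=; first by rewrite big_nil mul1r.
case/andP=> Ti Tw; rewrite big_cons -mulrA => Dy; apply: IH => //.
set c := _ * b in Dy *.
have Qc : Q c.
  rewrite /c; elim: w Tw {c Dy} => [|k w IHw] /=; first by rewrite big_nil mul1r.
  by case/andP=> Tk Tw; rewrite big_cons -mulrA; apply: Qy => //; exact: IHw.
have -> : c = e i * c + x i * (y i * c) by rewrite eeltE mulrBl mul1r mulrA subrK.
by apply: ideal_add; [exact: Qe | exact: ideal_mull].
Qed.

End LocalNilpotence.

Lemma foldr_pid j (s : seq 'I_m.+1) a : j \in s ->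
  foldr (fun i acc => ideal_mul (pid x y i) acc) (fun _ => True) s a -> pid x y j a.
Proof.
elim: s a => // i s IH a; rewrite inE => js /=.
apply: ideal_mono => z [b [c [ib sc ->]]].
case/orP: js => [/eqP->|js]; first exact: ideal_mulr.
by apply: ideal_mull; exact: IH sc.
Qed.

Lemma pS_ideal_e (S : {set 'I_m.+1}) a : pS x y S a ->
  ideal (fun z => exists2 i, i \in S & z = e i) a.
Proof.
apply: ideal_in_sub => // z [i iS]; apply: ideal_in_sub => // _ ->.
by apply: id_base; exists i.
Qed.

Lemma E_pid (s t : nat) i : pid x y i (E s t i).
Proof. by rewrite EeltE; apply/ideal_mullr/ideal_incl. Qed.

Definition triples (l : seq 'I_m.+1) z := exists i j,
  [/\ i \in l, j != i, j != n & z = e i * e j * e n].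

(** Absorption over [S] and then over [n] reduces the claim to products [e n * e i * q] with [q] in
    [ans 3]. A set of three indices has an element [j] outside [i] and [n], and a generator attached
    to that set lies in [pid j]. *)
Lemma pn_a3_triples (S : {set 'I_m.+1}) b : n \notin S ->
  ppn x y S b -> ans x y 3 b -> ideal (triples (enum S)) b.
Proof.
move=> nS Sb b3.
have Tb : ideal (fun z => exists2 i, i \in S & z = e i) b.
  apply: ideal_mono Sb => z [i iS]; apply: ideal_mono => _ [c [d [ic _ ->]]].
  apply: ideal_mulr; apply: ideal_mono ic => _ ->.
  by apply: ideal_incl; exists i.
have nb : pid x y n b.
  apply: ideal_mono Sb => z [i iS]; apply: ideal_mono => _ [c [d [_ nd ->]]].
  exact: ideal_mull.
apply: (@ideal_absorb (mem S) _ (fun c => pid x y n c /\ ans x y 3 c)) Tb _ => //.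
  by move=> i c _ [nc c3]; split; exact: ideal_mull.
move=> i c iS [nc c3]; have iS' : i \in S by [].
have i_n : i != n by apply: contraNneq nS => <-.
apply: (@ideal_absorb (pred1 n) _ (fun c => exists2 q, ans x y 3 q & c = e i * q)).
- move=> k _ /= /eqP -> [q q3 ->]; exists (y n * q); first exact: ideal_mull.
  rewrite !mulrA; congr (_ * _).
  apply: (@subalg_disjoint_comm _ _ _ _ _ rels (pred1 n) (predC1 n)).
  + by move=> k' /= /eqP ->; rewrite eqxx.
  + by apply: sg_y => /=.
  + by apply: subalg_e => /=.
- move=> k _ /= /eqP -> [q q3 ->]; rewrite mulrA.
  (* The fixed left factor blocks left multiples of [q]; quantifying over [r] makes the statement
     inductive. *)
  suff : forall r, ideal (triples (enum S)) (e n * e i * (r * q)).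
    by move/(_ 1); rewrite mul1r.
  move: q q3; apply: ideal_ind_closed => [q [I [I3 Iq]] r|r|a a' Ha Ha' r|s a Ha r|s a Ha r].
  + have [j] : exists j, j \in I :\: [set i; n].
      apply/set0Pn; rewrite -card_gt0 cardsD I3 subn_gt0.
      by rewrite (leq_ltn_trans (subset_leq_card (subsetIr _ _))) // cards2 i_n.
    rewrite !inE negb_or => /andP[/andP[ji jn] jI].
    have jq : pid x y j (r * q).
      by apply: ideal_mull; apply: foldr_pid Iq; rewrite mem_enum.
    have Jd : sub (predC1 j) (e n * e i).
      by apply: sg_mul; apply: subalg_e => /=; rewrite eq_sym.
    apply: ideal_mono (e_pid_mul Jd jq) => _ ->; apply: ideal_incl.
    exists i, j; rewrite mem_enum; split=> //.
    by rewrite (ee_comm n i) -!mulrA (ee_comm n j).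
  + by rewrite !mulr0; exact: ideal0.
  + by rewrite (mulrDr r) (mulrDr (e n * e i)); exact: ideal_add.
  + by rewrite (mulrA r s); exact: Ha.
  + by rewrite (mulrA r) (mulrA (e n * e i)); exact: ideal_mulr.
- apply: ideal_mono (ideal_mull (e i) nc) => _ ->.
  by apply: ideal_incl; exists n => /=.
- by exists c.
Qed.

End MonomialIdeals.

(** * Removing the summands p_i p_j p_n *)

Section Peeling.
Variables (K : fieldType) (A : algType K) (m : nat) (x y : 'I_m.+1 -> A).
Hypothesis jac : is_jacobian_algebra x y.
Local Notation n := (ord_max : 'I_m.+1).
Local Notation E := (Eelt x y).
Local Notation e := (eelt x y).
Local Notation sub := (subalg_gen x y).
Implicit Types (i j k : 'I_m.+1) (a b c d q u : A) (D : A -> Prop).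

Let rels : jac_rels x y. Proof. by case: jac. Qed.
Let gen : forall a, sub predT a. Proof. by case: jac => _ []. Qed.

(** The elements [e k * e n] generate all triples headed by an index [k] of [l], yet involve only
    [l] and [n]; [J] lists the second indices still to be removed for [i]. *)
Definition peel_gens i (l J : seq 'I_m.+1) z :=
  (exists2 k, k \in l & z = e k * e n) \/ (exists2 j, j \in J & z = e i * e j * e n).

Lemma Erel_mono (S S' : {set 'I_m.+1}) u : n \notin S -> S \subset S' ->
  Erel x y S u -> Erel x y S' u.
Proof.
move=> nS SS'.
have pSS' a : pS x y S a -> pS x y S' a.
  by apply: ideal_in_sub => // z [i /(subsetP SS') iS zi]; apply: id_base; exists i.
have GG' g : rel_gen x y S g -> rel_gen x y S' g.
  by case=> g0 [h [a [k [l [Eg gh /pSS' Sa kl ->]]]]]; exists g0, h, a, k, l.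
elim=> {u} [|g a /GG' Gg _ IH|g h a /GG' Gg gh hg _ IH].
- exact: gg_one.
- exact: gg_mul.
- exact: gg_inv gh hg IH.
Qed.

Lemma peel_coset i (l J : seq 'I_m.+1) u : i != n -> n \notin l -> uniq J ->
  (forall j, j \in J -> [/\ j != i, j != n & j \notin l]) ->
  is_unit_el u -> ideal (peel_gens i l J) (u - 1) ->
  coset_mod (rel_gen x y [set i]) (peel_gens i l [::]) u.
Proof.
move=> i_n nl; have nS : n \notin [set i] by rewrite inE eq_sym.
elim: J u => [|j J IH] u.
  by move=> _ _ _ Iu; exists 1 => //; exact: gg_one.
case/andP=> jJ uJ HJ [u' [uu' u'u]] Iu.
have [ji jn jl] := HJ j (mem_head _ _).
have {}Iu : ideal (fun z => z = e i * e j * e n \/ peel_gens i l J z) (u - 1).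
  apply: ideal_mono Iu => z [[k kl ->]|[k]].
    by apply: ideal_incl; right; left; exists k.
  rewrite inE => /orP[/eqP->|kJ] ->; apply: ideal_incl; first by left.
  by right; right; exists k.
have [b [q [Ib Iq ub]]] := ideal_union Iu.
(* The index [j] differs from [i] and [n], lies outside [l], and is kept out of the tail by
   uniqueness; this is what cancelling [e j] requires. *)
have ncancel z : peel_gens i l J z -> sub (predC1 j) z.
  case=> [[k kl ->]|[k kJ ->]].
    apply: sg_mul; apply: subalg_e => /=; last by rewrite eq_sym.
    by apply: contraNneq jl => <-.
  apply: sg_mul; last by apply: subalg_e => /=; rewrite eq_sym.
  apply: sg_mul; apply: subalg_e => /=; first by rewrite eq_sym.
  by apply: contraNneq jJ => <-.
have [eps Geps Ieps] : coset_mod (rel_gen x y [set i]) (peel_gens i l J) u.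
  apply: (@triple_ideal_coset _ _ _ _ _ rels j jn [set i] _ i) uu' u'u ub Ib Iq => //.
  - by rewrite inE.
  - by rewrite eq_sym.
  - by move=> d Jd; apply: (e_cancel jac).
have [eps' [ee' e'e Geps']] := gen_group_inv (rel_gen_unit rels nS) Geps.
have u1unit : is_unit_el (eps' * u).
  exists (u' * eps); split; first by rewrite mulrA -(mulrA eps') uu' mulr1.
  by rewrite mulrA -(mulrA u') ee' mulr1.
have Iu1 : ideal (peel_gens i l J) (eps' * u - 1).
  by rewrite -e'e -mulrBr; exact: ideal_mull.
have HJ' k : k \in J -> [/\ k != i, k != n & k \notin l].
  by move=> kJ; apply: HJ; rewrite inE kJ orbT.
have [del Gdel Idel] := IH _ uJ HJ' u1unit Iu1.
exists (eps * del); first exact: gen_groupM.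
have -> : u - eps * del = eps * (eps' * u - del) by rewrite mulrBr mulrA ee' mul1r.
exact: ideal_mull.
Qed.

Lemma rel_gen_cong1 i u : i != n -> rel_gen x y [set i] u ->
  ideal (fun z => z = e i * e n) (u - 1).
Proof.
move=> i_n [g [h [a [k [l [_ [gh hg] Sa kl ->]]]]]].
have -> : g * (1 + a * E k l n) * h - 1 = g * (a * E k l n) * h.
  by rewrite mulrDr mulr1 mulrDl gh addrAC subrr add0r.
apply: ideal_mullr; apply: (ideal_pid_mul rels gen); last exact: E_pid.
  by apply: subalg_e => /=.
by apply: ideal_mono (pS_ideal_e Sa) => _ [j /set1P -> ->]; exact: ideal_incl.
Qed.

(** Induction on the list: the relative group of the single index [i] clears the triples headed by
    [i], and the quotient unit satisfies the hypothesis for the tail. *)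
Lemma triples_Erel (l : seq 'I_m.+1) (S : {set 'I_m.+1}) u :
  uniq l -> {subset l <= S} -> n \notin S -> is_unit_el u ->
  ideal (triples x y l) (u - 1) -> Erel x y S u.
Proof.
move=> ul lS nS; elim: l ul lS u => [|i l IH] /=.
  move=> _ _ u _ Iu; suff -> : u = 1 by exact: gg_one.
  apply/eqP; rewrite -subr_eq0; apply/eqP; move: (u - 1) Iu.
  apply: ideal_ind_closed => // [a [i [j []]]//|a b -> ->|r a ->|r a ->].
  - by rewrite addr0.
  - by rewrite mulr0.
  - by rewrite mul0r.
case/andP=> il ul ilS u uunit Iu.
have iS : i \in S by apply: ilS; rewrite mem_head.
have lS k : k \in l -> k \in S by move=> kl; apply: ilS; rewrite inE kl orbT.
have i_n : i != n by apply: contraNneq nS => <-.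
have nl : n \notin l by apply: contra nS; exact: lS.
have n_i : n \notin [set i] by rewrite inE eq_sym.
have nk k : k \in l -> k != n by move=> kl; apply: contraNneq nl => <-.
pose J := [seq j <- enum 'I_m.+1 | [&& j != i, j != n & j \notin l]].
have IJ : ideal (peel_gens i l J) (u - 1).
  apply: ideal_mono Iu => _ [k [j [kil jk jn ->]]].
  have [kl|] := boolP (k \in l).
    rewrite (ee_comm rels k) -mulrA; apply/ideal_mull/ideal_incl.
    by left; exists k.
  move: kil; rewrite inE => /orP[/eqP ki _|->//]; rewrite {}ki in jk *.
  have [jl|jl] := boolP (j \in l).
    by rewrite -mulrA; apply/ideal_mull/ideal_incl; left; exists j.
  by apply: ideal_incl; right; exists j; rewrite // mem_filter jk jn jl mem_enum.
have [|j|eps Geps Ieps] := peel_coset i_n nl _ _ uunit IJ.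
- by rewrite filter_uniq // enum_uniq.
- by rewrite mem_filter => /andP[/and3P[]].
have [eps' [ee' e'e Geps']] := gen_group_inv (rel_gen_unit rels n_i) Geps.
have [u' [uu' u'u]] := uunit.
have -> : u = eps * (eps' * u) by rewrite mulrA ee' mul1r.
apply: gen_groupM; first by apply: Erel_mono Geps; rewrite // sub1set.
apply: IH => //.
  exists (u' * eps); split; first by rewrite mulrA -(mulrA eps') uu' mulr1.
  by rewrite mulrA -(mulrA u') ee' mulr1.
(* The new difference lies in the ideal of the [e k] with [k] in [l], by peeling, and in that of
   [e i * e n] and the triples over [l], because [eps] is congruent to 1 modulo [e i * e n].
   Multiplication by [e k] turns [e i * e n] into a triple headed by [k]. *)
apply: (@ideal_absorb _ _ _ _ _ rels gen (mem l) _
  (ideal (fun z => z = e i * e n \/ triples x y l z))).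
- by move=> k c _; exact: ideal_mull.
- move=> k c kl Ic; have {}kl : k \in l by [].
  have ki : k != i by apply: contraNneq il => <-.
  suff : forall r, ideal (triples x y l) (e k * (r * c)) by move/(_ 1); rewrite mul1r.
  move: c Ic; apply: ideal_ind_closed => [z [->|tz] r|r|a a' Ha Ha' r|s a Ha r|s a Ha r].
  + rewrite (mulrA r) (mulrA (e k)).
    have ri : pid x y i (r * e i) by apply/ideal_mull/ideal_incl.
    have Jk : sub (predC1 i) (e k) by apply: subalg_e => /=.
    have Jki : sub (predC1 n) (e k * e i).
      by apply: sg_mul; apply: subalg_e => //=; exact: nk.
    have nn : pid x y n (e n) by exact: ideal_incl.
    apply: ideal_mono (ideal_pid_mul rels gen Jki (e_pid_mul rels gen Jk ri) nn) => _ ->.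
    by apply: ideal_incl; exists k, i; split=> //; rewrite eq_sym.
  + by do 2!apply: ideal_mull; exact: ideal_incl.
  + by rewrite !mulr0; exact: ideal0.
  + by rewrite (mulrDr r) (mulrDr (e k)); exact: ideal_add.
  + by rewrite (mulrA r); exact: Ha.
  + by rewrite (mulrA r) (mulrA (e k)); exact: ideal_mulr.
- rewrite -e'e -mulrBr; apply: ideal_mull.
  apply: ideal_mono Ieps => z [[k kl ->]|[]//].
  by apply/ideal_mulr/ideal_incl; exists k.
- have -> : eps' * u - 1 = eps' * (u - 1) + (eps' - 1) by rewrite mulrBr mulr1 addrA subrK.
  apply: ideal_add.
    apply: ideal_mull; apply: ideal_mono Iu => _ [k [j [kil jk jn ->]]].
    move: kil; rewrite inE => /orP[/eqP->|kl].
      by rewrite (ee_comm rels i j) -mulrA; apply/ideal_mull/ideal_incl; left.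
    by apply: ideal_incl; right; exists k, j.
  apply: ideal_mono (gen_group_cong1 (fun g => @rel_gen_cong1 i g i_n) Geps') => _ ->.
  by apply: ideal_incl; left.
Qed.

Lemma units_ppn_3_Erel (S : {set 'I_m.+1}) u : n \notin S ->
  units_ppn_3 x y S u -> Erel x y S u.
Proof.
move=> nS [[uunit Su] [_ u3]].
apply: (@triples_Erel (enum S)) => //; first exact: enum_uniq.
  by move=> i; rewrite mem_enum.
exact: (pn_a3_triples rels gen).
Qed.

End Peeling.

(** * Products of the groups E_oo(S_CI) *)

Section ProductSets.
Variables (R : pzRingType) (I : eqType) (G : I -> R -> Prop).

Definition normal_unit_group (P : R -> Prop) :=
  [/\ P 1, forall u v, P u -> P v -> P (u * v), forall u, P u -> is_unit_el u
    & forall g h u, g * h = 1 -> h * g = 1 -> P u -> P (g * u * h)].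

(** Normality in the full unit group moves a factor past elements of the later groups, so products
    taken in a fixed order are closed under multiplication. *)
Lemma prodset_normal (s : seq I) : (forall i, i \in s -> normal_unit_group (G i)) ->
  normal_unit_group (prodset [seq G i | i <- s]).
Proof.
elim: s => [|i t IH] /= Gt.
  split=> // [u v -> ->|u ->|g h u gh hg ->]; first by rewrite mulr1.
    by exists 1; rewrite mulr1.
  by rewrite mulr1.
have [G1 GM GU GN] := Gt i (mem_head _ _).
have [|t1 tM tU tN] := IH; first by move=> k kt; apply: Gt; rewrite inE kt orbT.
split.
- by exists 1, 1; rewrite mulr1.
- move=> _ _ [b [c [Gb tc ->]]] [b' [c' [Gb' tc' ->]]].
  have [d [cd dc]] := tU c tc.
  exists (b * (c * b' * d)), (c * c'); split; [|exact: tM|].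
    by apply: GM => //; exact: GN.
  by rewrite -!mulrA (mulrA d) dc mul1r.
- move=> _ [b [c [/GU[b' [bb' b'b]] /tU[c' [cc' c'c]] ->]]]; exists (c' * b'); split.
    by rewrite mulrA -(mulrA b) cc' mulr1.
  by rewrite mulrA -(mulrA c') b'b mulr1.
- move=> g h _ gh hg [b [c [Gb tc ->]]].
  exists (g * b * h), (g * c * h); split; [exact: GN | exact: tN |].
  by rewrite -!mulrA (mulrA h) hg mul1r.
Qed.

Lemma prodset_incl (s : seq I) i u : (forall i, i \in s -> normal_unit_group (G i)) ->
  i \in s -> G i u -> prodset [seq G k | k <- s] u.
Proof.
elim: s => // k t IH Gt; rewrite inE => it Gu /=.
have [G1 _ _ _] := Gt k (mem_head _ _).
have Gt' j : j \in t -> normal_unit_group (G j) by move=> jt; apply: Gt; rewrite inE jt orbT.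
case/orP: it => [/eqP ik|it]; last by exists 1, u; rewrite mul1r; split=> //; exact: IH.
exists u, 1; rewrite mulr1 -ik; split=> //.
by have [] := prodset_normal Gt'.
Qed.

Lemma prodset_cat1 (l : seq (R -> Prop)) (P : R -> Prop) u :
  prodset l u -> P 1 -> prodset (l ++ [:: P]) u.
Proof.
move=> lu P1; elim: l u lu => [u /= ->|Q l IH u /= [b [c [Qb /IH lc ->]]]].
  by exists 1, 1; rewrite mulr1.
by exists b, c.
Qed.

Lemma prodset_cat1_sub (s : seq I) (P Q : R -> Prop) :
  Q 1 -> (forall u v, Q u -> Q v -> Q (u * v)) ->
  (forall i u, i \in s -> G i u -> Q u) -> (forall u, P u -> Q u) ->
  forall u, prodset ([seq G i | i <- s] ++ [:: P]) u -> Q u.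
Proof.
move=> Q1 QM GQ PQ; elim: s GQ => [|i s IH] GQ u /= [b [c [Gb sc ->]]]; apply: QM.
- exact: PQ.
- by rewrite sc.
- by apply: GQ Gb; exact: mem_head.
- by apply: IH sc => k v ks; apply: GQ; rewrite inE ks orbT.
Qed.

End ProductSets.

(** * The groups of the pairs {i, n} and their normality among all units *)

Section PairGroups.
Variables (K : fieldType) (A : algType K) (m : nat) (x y : 'I_m.+1 -> A).
Hypothesis rels : jac_rels x y.
Hypothesis gen : forall a, subalg_gen x y predT a.
Local Notation n := (ord_max : 'I_m.+1).
Local Notation E := (Eelt x y).
Local Notation e := (eelt x y).
Local Notation sub := (subalg_gen x y).
Local Notation Sn1 := (Snm1 x y).

(** The product follows the enumeration of the index type; both orders of [i] and [n] are treated,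
    and the two factors commute. *)
Lemma Emat_pair (i : 'I_m.+1) (al be : 'I_m.+1 -> nat) : i != n ->
  Emat x y [set i; n] al be = E (al i) (be i) i * E (al n) (be n) n.
Proof.
move=> i_n; rewrite /Emat -big_filter.
have EC : E (al n) (be n) n * E (al i) (be i) i = E (al i) (be i) i * E (al n) (be n) n.
  by apply: (Snm1_E_comm rels); exact: subalgE.
have smem k : (k \in [seq k <- index_enum 'I_m.+1 | k \in [set i; n]]) = (k == i) || (k == n).
  by rewrite mem_filter mem_index_enum andbT !inE.
have us := filter_uniq (mem [set i; n]) (index_enum_uniq 'I_m.+1).
have ps : perm_eq [seq k <- index_enum 'I_m.+1 | k \in [set i; n]] [:: i; n].
  by apply: uniq_perm => [//||k]; rewrite /= ?inE ?i_n // smem inE.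
have := perm_size ps; case: filter us smem {ps} => [|a [|b [|c s]]] //= ab smem _.
move: ab; rewrite !inE andbT => ab.
rewrite !big_cons big_nil mulr1.
have := smem a; rewrite mem_head => /esym/orP[] /eqP ai;
  have := smem b; rewrite !inE eqxx orbT => /esym/orP[] /eqP bi; subst a b => //;
  by rewrite eqxx in ab.
Qed.

Section Pair.
Variable i : 'I_m.+1.
Hypothesis i_n : i != n.
Local Notation SCi := (SC x y [set i; n]).
Local Notation F := (bimat x y i).

Definition pair_gen u := exists a (s t k l : nat),
  [/\ SCi a, (s != t) || (k != l) & u = 1 + F a s t k l].

Lemma Einf_pair u : Einf x y [set i; n] u <-> gen_group pair_gen u.
Proof.
have n_i : (n == i) = false by rewrite eq_sym (negPf i_n).
have gens v : (exists a (al be : 'I_m.+1 -> nat), [/\ SCi a,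
    exists2 k, k \in [set i; n] & al k != be k & v = 1 + a * Emat x y [set i; n] al be])
    <-> pair_gen v.
  split=> [[a [al [be [Ja [k kI alk ->]]]]]|[a [s [t [k [l [Ja ne ->]]]]]]].
    exists a, (al i), (be i), (al n), (be n); rewrite Emat_pair // mulrA.
    split=> //; move: kI; rewrite !inE => /orP[] /eqP <-; by rewrite alk ?orbT.
  exists a, (fun q => if q == i then s else k), (fun q => if q == i then t else l).
  rewrite Emat_pair // eqxx n_i mulrA; split=> //.
  case/orP: ne => [st|kl]; first by exists i; rewrite ?eqxx // !inE eqxx.
  by exists n; rewrite ?inE ?eqxx ?orbT ?n_i.
split; elim=> {u} [|g a /gens Gg _ IH|g h a /gens Gg gh hg _ IH]; try exact: gg_one.
- exact: gg_mul.
- exact: gg_inv gh hg IH.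
- exact: gg_mul.
- exact: gg_inv gh hg IH.
Qed.

Lemma bimat_sq0 a s t k l : SCi a -> (s != t) || (k != l) ->
  F a s t k l * F a s t k l = 0.
Proof.
move=> Ja ne; rewrite (bimatM rels) // eq_sym (eq_sym l).
by case/orP: ne => /negPf ->; rewrite ?andbF.
Qed.

Lemma pair_gen_unit u : pair_gen u -> is_unit_el u.
Proof.
case=> a [s [t [k [l [Ja ne ->]]]]]; exists (1 - F a s t k l).
exact/square_zero_inverse/bimat_sq0.
Qed.

Lemma bimatN a s t k l : - F a s t k l = F (- a) s t k l.
Proof. by rewrite /bimat !mulNr. Qed.

Lemma bimat_ideal a s t k l : ideal (fun z => z = e i * e n) (F a s t k l).
Proof.
apply: (ideal_pid_mul rels gen); last exact: E_pid.
  by apply: subalg_e => /=.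
by apply: ideal_mull; exact: E_pid.
Qed.

Let P z := exists b s t, SCi b /\ z = b * E s t i.

Lemma pair_ideal_mspan z : ideal (fun z => z = e i * e n) z ->
  exists M, mspan x y n P M z.
Proof.
move=> Iz; have [M dz] : exists M, dspan x y i (ideal_in SCi (fun d => d = 1)) M z.
  apply: (ideal_dspan rels) => //; first by move=> _ ->; exact: subalg1.
  by apply: ideal_mono Iz => _ ->; apply: ideal_incl; exists 1; rewrite ?mul1r.
exists M; apply: add_span_sub dz => _ [b [s [t [k [l [Pb _ kM lM ->]]]]]].
apply: mspan_elt => //; exists b, s, t; split=> //.
by apply: ideal_in_subalg Pb => _ ->; exact: subalg1.
Qed.

(* With matrix units in place of basis vectors, the conjugate is 1 + v w for a
   column v and a row w with w v = 0; shifting the row index of w by a large M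
   writes it as a commutator of elementary matrices. *)
Lemma pair_gen_conj g h u : g * h = 1 -> h * g = 1 -> pair_gen u ->
  gen_group pair_gen (g * u * h).
Proof.
move=> gh hg [a [s [t [k [l [Ja ne ->]]]]]].
pose v := g * F a s 0 k 0; pose w := F 1 0 t 0 l * h.
have J1 : SCi 1 by exact: subalg1.
have -> : g * (1 + F a s t k l) * h = 1 + v * w.
  rewrite mulrDr mulr1 mulrDl gh; congr (_ + _).
  rewrite /v /w mulrA -(mulrA g (F a s 0 k 0)) (bimatM rels) // !eqxx /= mulr1.
  by rewrite mulrA.
(* The relation [h g = 1] brings the two matrix units together, and (t, l) differs from (s, k). *)
have wv : w * v = 0.
  rewrite /w /v mulrA -(mulrA _ h) hg mulr1 (bimatM rels) // (eq_sym t) (eq_sym l).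
  by case/orP: ne => /negPf ->; rewrite ?andbF.
have [M1 Sv] : exists M, mspan x y n P M v.
  by apply/pair_ideal_mspan/ideal_mull/bimat_ideal.
have [M2 Sw] : exists M, mspan x y n P M w.
  by apply/pair_ideal_mspan/ideal_mulr/bimat_ideal.
pose M := maxn M1 M2.
have {}Sv : mspan x y n P M v by apply: mspan_le Sv; exact: leq_maxl.
have {}Sw : mspan x y n P M w by apply: mspan_le Sw; exact: leq_maxr.
have PS z : P z -> Sn1 z.
  by case=> b [s' [t' [Jb ->]]]; apply: sg_mul; [exact: SCj_Sn1 Jb | exact: subalgE].
have PN z : P z -> P (- z).
  case=> b [s' [t' [Jb ->]]]; exists (- b), s', t'; rewrite mulNr; split=> //.
  exact: subalgN.
(* Distinct [n]-indices suffice for a generator, whatever the indices at [i], so shifting in [n]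
   alone is enough. *)
have PG z k' l' : P z -> k' != l' -> gen_group pair_gen (1 + z * E k' l' n).
  case=> b [s' [t' [Jb ->]]] kl; apply: gen_group_incl.
  by exists b, s', t', k', l'; rewrite kl orbT.
rewrite -(commutator_word (yxX rels n M) (mspan_yX rels PS Sv) (mspan_xX rels Sw) wv).
rewrite -mulNr -mulrN; do !apply: gen_groupM.
- exact: (span_upper rels PS PG Sv).
- exact: (span_lower rels PS PG Sw).
- exact: (span_upper rels PS PG (mspanN PN Sv)).
- exact: (span_lower rels PS PG (mspanN PN Sw)).
Qed.

Lemma Einf_normal : normal_unit_group (Einf x y [set i; n]).
Proof.
split.
- exact: gg_one.
- exact: gen_groupM.
- by move=> u /Einf_pair/(gen_group_inv pair_gen_unit)[v [uv vu _]]; exists v.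
- move=> g h u gh hg /Einf_pair Gu; apply/Einf_pair.
  have conjM a b : g * (a * b) * h = g * a * h * (g * b * h).
    by rewrite -!mulrA (mulrA h) hg mul1r.
  elim: Gu => {u} [|r u Gr _ IH|r s u Gr rs sr _ IH].
  + by rewrite mulr1 gh; exact: gg_one.
  + by rewrite conjM; apply: gen_groupM => //; exact: pair_gen_conj.
  + rewrite conjM; apply: gen_groupM => //.
    have [v [rv vr Gv]] := gen_group_inv pair_gen_unit (pair_gen_conj gh hg Gr).
    suff -> : g * s * h = v by [].
    by apply: inverse_unique rv; rewrite -conjM sr mulr1 gh.
Qed.

Lemma Einf_Erel (S : {set 'I_m.+1}) u : i \in S -> n \notin S ->
  Einf x y [set i; n] u -> Erel x y S u.
Proof.
move=> iS nS /Einf_pair.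
have offdiag a s t k l : SCi a -> k != l -> Erel x y S (1 + F a s t k l).
  move=> Ja kl; apply: Erel_incl => //.
  apply: id_base; exists i => //; apply: id_mull; first exact: SCj_Sn1 Ja.
  rewrite EeltE; apply: id_mulr; first by apply: subalgX; exact: sg_y.
  apply: id_mull; first by apply: subalgX; exact: sg_x.
  exact: id_base.
have gens v : pair_gen v -> Erel x y S v.
  case=> a [s [t [k [l [Ja ne ->]]]]].
  have [kl|kl] := boolP (k != l); first exact: offdiag.
  move: ne; rewrite (negPf kl) orbF => st; move/negPn/eqP: kl => <-.
  have J1 : SCi 1 by exact: subalg1.
  have kS : k != k.+1 by rewrite neq_ltn leqnn.
  (* A unit diagonal in [n] is a commutator through the auxiliary index [k.+1]. Both factors are
     off-diagonal in [n] with entries in the ideal, and [s != t] makes [Y X] and [Y Y] vanish. *)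
  pose X := F a s s k k.+1; pose Y := F 1 s t k.+1 k.
  have -> : F a s t k k = X * Y by rewrite (bimatM rels) // !eqxx mulr1.
  rewrite -square_zero_commutator; first last.
  - by rewrite (bimatM rels) // eq_sym (negPf st).
  - by apply: bimat_sq0 => //; rewrite st.
  - by apply: bimat_sq0; rewrite // kS orbT.
  rewrite /X /Y !bimatN; do !apply: gen_groupM; apply: offdiag => //; rewrite 1?eq_sym //.
  - exact: subalgN.
  - exact: subalgN.
apply: gen_group_sub => [g|g h Gg gh hg]; first exact: gens.
have [v [gv vg Gv]] := gen_group_inv (rel_gen_unit rels nS) (gens g Gg).
by have -> : h = v by exact: inverse_unique hg gv.
Qed.

End Pair.

Section Product.
Variable S : {set 'I_m.+1}.
Hypothesis nS : n \notin S.
Local Notation Js := (enum [pred J : {set 'I_m.+1} | (#|J| == 2) && Jp S J]).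

Lemma pairs_mem J : J \in Js -> exists i, [/\ i \in S, i != n & J = [set i; n]].
Proof.
rewrite mem_enum inE /Jp => /andP[/eqP J2 /andP[nJ /set0Pn[i]]].
rewrite inE => /andP[iJ iS].
have i_n : i != n by apply: contraNneq nS => <-.
exists i; split=> //; apply/esym/eqP; rewrite eqEcard cards2 i_n J2 leqnn andbT.
by apply/subsetP => k; rewrite !inE => /orP[] /eqP ->.
Qed.

Lemma pair_in_Js i : i \in S -> [set i; n] \in Js.
Proof.
move=> iS; have i_n : i != n by apply: contraNneq nS => <-.
rewrite mem_enum inE /Jp cards2 i_n eqxx !inE eqxx orbT /=.
by apply/set0Pn; exists i; rewrite !inE eqxx.
Qed.

Lemma Js_normal J : J \in Js -> normal_unit_group (Einf x y J).
Proof. by case/pairs_mem=> i [_ i_n ->]; exact: Einf_normal. Qed.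

(** For fixed [k != l] the element [1 + a E_kl(n)] turns sums in [a] into products; this splitting
    makes each factor a generator for a single pair {i, n}. *)
Lemma pS_add_span a : pS x y S a -> add_span (fun z => exists i b s t,
  [/\ i \in S, SC x y [set i; n] b & z = b * E s t i]) a.
Proof.
move=> Sa; have : add_span (fun z => exists2 i, i \in S & pprime x y i z) a.
  elim: Sa => {a} [a Sa||a b _ IHa _ IHb|r a Sr _ IH|r a Sr _ IH].
  - exact: span_incl.
  - exact: span_0.
  - exact: span_add.
  - elim: IH => {a} [a [i iS ia]||a b _ IHa _ IHb].
    + by apply: span_incl; exists i => //; exact: id_mull.
    + by rewrite mulr0; exact: span_0.
    + by rewrite mulrDr; exact: span_add.
  - elim: IH => {a} [a [i iS ia]||a b _ IHa _ IHb].
    + by apply: span_incl; exists i => //; exact: id_mulr.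
    + by rewrite mul0r; exact: span_0.
    + by rewrite mulrDl; exact: span_add.
apply: add_span_sub => {a Sa} a [i iS ia].
have [M] : exists M, mspan x y i (ideal_in (SC x y [set i; n]) (fun d => d = 1)) M a.
  apply: (@ideal_mspan _ _ _ _ _ rels i _ (fun k => k != n)).
  - by rewrite !inE eqxx.
  - by move=> k kn; rewrite !inE; case: (eqVneq k i) => [->|]; [left | right].
  - by move=> _ ->; exact: subalg1.
  - by apply: ideal_in_sub ia => // _ ->; apply: id_base; exists 1; rewrite ?mul1r.
apply: add_span_sub => _ [b [s [t [Pb _ _ ->]]]]; apply: span_incl.
exists i, b, s, t; split=> //.
by apply: ideal_in_subalg Pb => _ ->; exact: subalg1.
Qed.

Lemma rel_gen_prodset u : rel_gen x y S u -> prodset [seq Einf x y J | J <- Js] u.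
Proof.
case=> g [h [a [k [l [_ [gh hg] /pS_add_span Sa kl ->]]]]].
have [p1 pM _ pN] := prodset_normal Js_normal.
(* Membership in [Sn1] is carried along because it lets the coefficient commute with [E k l n], so
   that the cross term of a product vanishes. *)
suff [_] : Sn1 a /\ prodset [seq Einf x y J | J <- Js] (g * (1 + a * E k l n) * h) by [].
elim: Sa => {a} [_ [i [b [s [t [iS Jb ->]]]]]||a b _ [Sa IHa] _ [Sb IHb]].
- have i_n : i != n by apply: contraNneq nS => <-.
  split; first by apply: sg_mul; [exact: SCj_Sn1 Jb | exact: subalgE].
  apply: pN => //; apply: (prodset_incl Js_normal (pair_in_Js iS)).
  apply/Einf_pair => //; apply: gen_group_incl.
  by exists b, s, t, k, l; rewrite kl orbT.
- by split; [exact: subalg0 | rewrite mul0r addr0 mulr1 gh].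
- split; first exact: sg_add.
  suff -> : g * (1 + (a + b) * E k l n) * h =
    g * (1 + a * E k l n) * h * (g * (1 + b * E k l n) * h) by exact: pM.
  rewrite -!mulrA (mulrA h) hg mul1r (mulrA (1 + a * _)); congr (_ * (_ * _)).
  rewrite [RHS]mulrDr mulr1 (mulrDl 1 (a * _)) mul1r offdiag_mul0 // addr0.
  by rewrite mulrDl addrA.
Qed.

Lemma Erel_prodset u : Erel x y S u -> prodset [seq Einf x y J | J <- Js] u.
Proof.
have [p1 pM _ pN] := prodset_normal Js_normal.
elim=> {u} [|g a Gg _ IH|g h a Gg gh hg _ IH] //.
  by apply: pM => //; exact: rel_gen_prodset.
apply: pM => //; apply: rel_gen_prodset.
case: Gg gh hg => g1 [h1 [b [k [l [Eg1 [gh1 hg1] Sb kl ->]]]]] gh hg.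
exists g1, h1, (- b), k, l; split=> //.
  by rewrite -mulN1r; apply: id_mull => //; apply/subalgN/subalg1.
apply: inverse_unique hg _.
have [q1 _] := elem_gen_inv rels (pS_Snm1 nS Sb) kl.
by rewrite mulNr -!mulrA (mulrA h1) hg1 mul1r (mulrA (1 + _)) q1 mul1r.
Qed.

End Product.
End PairGroups.

Theorem theorem5p7 (K : fieldType) (A : algType K) (m : nat) (x y : 'I_m.+1 -> A)
    (S : {set 'I_m.+1}) :
  (3 <= m.+1)%N ->
  is_jacobian_algebra x y ->
  S != set0 ->
  ord_max \notin S ->
  forall u : A, Ecal x y S u <-> Erel x y S u.
Proof.
move=> _ jac _ nS u; have [rels [gen _]] := jac.
split=> [|Eu].
  apply: prodset_cat1_sub => [||J v|v].
  - exact: gg_one.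
  - exact: gen_groupM.
  - by case/(pairs_mem nS)=> i [iS i_n ->]; exact: Einf_Erel.
  - exact: units_ppn_3_Erel.
(* The factor from [units_ppn_3] is taken to be 1, the pair groups already containing the relative
   group in their product. *)
apply: prodset_cat1; first exact: Erel_prodset.
have unit1 : is_unit_el (1 : A) by exists 1; rewrite mulr1.
by split; split=> //; rewrite subrr; exact: ideal0.
Qed.
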